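(* There exist singular foliations of rank $r$ that, even locally, cannot be induced by a Lie algebroid of rank $r$. That is: there exist a manifold $M$, a singular foliation $\mathcal F$ on $M$ and a point $m\in M$ such that, with $r$ the rank of $\mathcal F$ at $m$, for no open neighborhood $U$ of $m$ does there exist a Lie algebroid $(A,[\cdot,\cdot],\rho)$ over $U$ with $A$ of rank $r$ and $\rho(\Gamma(A))=\mathcal F|_U$.
   Context: Manifolds are smooth, real analytic, or complex, with $\mathscr O$ the corresponding sheaf of functions; vector fields, vector bundles, sections $\Gamma(\cdot)$ and Lie algebroids are taken in the same category. A singular foliation is a subsheaf $\mathcal F$ of the sheaf of vector fields consisting of $\mathscr O$-modules, closed under the Lie bracket and locally finitely generated. Its rank at $m$ is the minimal number of generators of $\mathcal F$ as an $\mathscr O$-module in a neighborhood of $m$. *)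

(* Defs.v *)
From HB Require Import structures.
From mathcomp Require Import all_boot all_order all_algebra.
From mathcomp Require Import complex.
From mathcomp Require Import all_classical all_reals all_analysis.
Set Implicit Arguments.
Unset Strict Implicit.
Unset Printing Implicit Defensive.
Import Order.TTheory GRing.Theory Num.Theory.
Import numFieldNormedType.Exports.
Local Open Scope classical_set_scope.
Local Open Scope ring_scope.
Local Open Scope complex_scope.

(* Conventions.  A function, section or vector field defined on an open set V
   is represented by a total function whose values outside V are irrelevant:
   every predicate and every equality below is relative to V.  Sheaves are
   predicates indexed by the open set V. *)

Section RegularFunctionsOnAffineSpace.
Variables (K : numFieldType) (n : nat).
Implicit Types (U : set 'rV[K]_n) (f : 'rV[K]_n -> K^o).

Definition basis_vector (i : 'I_n) : 'rV[K]_n := delta_mx 0 i.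

Fixpoint of_class (k : nat) U f : Prop :=
  (forall x, U x -> {for x, continuous f}) /\
  if k is k'.+1 then
    forall i, (forall x, U x -> derivable f x (basis_vector i)) /\
      of_class k' U (fun x => 'D_(basis_vector i) f x)
  else True.

Definition smooth U f := forall k, of_class k U f.

(* f is locally the sum of an absolutely convergent power series
   sum_alpha c(alpha) (x - a)^alpha; the balls of 'rV[K]_n are polydiscs.
   For K complex this is the definition of holomorphic functions of several
   variables by power series. *)
Definition analytic U f :=
  forall a, U a -> exists (c : ('I_n -> nat) -> K) (r B : K),
    [/\ 0 < r,
        forall N, \sum_(alpha : {ffun 'I_n -> 'I_N})
          `|c (fun i => alpha i)| * \prod_i r ^+ alpha i <= B &
        forall x, ball a r x ->
          (fun N => \sum_(alpha : {ffun 'I_n -> 'I_N})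
             c (fun i => alpha i) * \prod_i (x 0 i - a 0 i) ^+ alpha i : K^o)
            @ \oo --> f x].

End RegularFunctionsOnAffineSpace.

(* The ground field, and the sheaf of functions on the open subsets of the
   affine spaces over it, on which the manifolds are modelled. *)
Structure function_theory := FunctionTheory {
  scalars : numFieldType;
  model_regular : forall n, set 'rV[scalars]_n -> ('rV[scalars]_n -> scalars) ->
    Prop }.

Inductive category := Smooth | RealAnalytic | Holomorphic.

Definition functions (R : realType) (k : category) : function_theory :=
  match k with
  | Smooth => @FunctionTheory R (@smooth R)
  | RealAnalytic => @FunctionTheory R (@analytic R)
  | Holomorphic => @FunctionTheory R[i] (@analytic R[i])
  end.

Section Manifolds.
Variable O : function_theory.
Local Notation K := (scalars O).

Record chart (M : topologicalType) (n : nat) := Chart {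
  chart_dom : set M;
  chart_map :> M -> 'rV[K]_n;
  chart_inv : 'rV[K]_n -> M }.

Definition chart_image (M : topologicalType) n (c : chart M n) (V : set M) :
  set 'rV[K]_n := c @` (V `&` chart_dom c).

(* The last two conditions say that c is a homeomorphism from its domain onto
   its image. *)
Definition is_chart (M : topologicalType) n (c : chart M n) : Prop :=
  [/\ open (chart_dom c),
      forall x, chart_dom c x -> chart_inv c (c x) = x,
      forall x, chart_dom c x -> {for x, continuous c} &
      forall V, open V -> open (chart_image c V)].

Structure manifold := Manifold {
  space :> topologicalType;
  dim : nat;
  atlas : set (chart space dim);
  manifold_hausdorff : hausdorff_space space;
  manifold_second_countable : @second_countable space;
  atlas_chart : forall c, atlas c -> is_chart c;
  atlas_cover : forall x : space, exists2 c, atlas c & chart_dom c x;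
  atlas_transition : forall c d, atlas c -> atlas d -> forall j,
    model_regular (chart_image c (chart_dom d))
      (fun y => d (chart_inv c y) 0 j) }.

Variable M : manifold.
Implicit Types (U V W : set M) (f : M -> K).

(* f is a section of the structure sheaf of M over V *)
Definition regular V f : Prop :=
  forall c : chart M (dim M), atlas c ->
    model_regular (chart_image c V) (fun y => f (chart_inv c y)).

Definition partial (c : chart M (dim M)) (i : 'I_(dim M)) f (x : M) : K :=
  'D_(basis_vector K i) ((fun y => f (chart_inv c y)) : 'rV[K]_(dim M) -> K^o)
    (c x).

(* Vector fields act on functions, f |-> X[f]. *)
Definition operator := (M -> K) -> M -> K.
Implicit Types X Y Z : operator.

(* In every chart of the atlas, X = sum_i a_i d/dx_i on V with regular a_i. *)
Definition vector_field V X : Prop :=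
  forall c : chart M (dim M), atlas c ->
  exists a : 'I_(dim M) -> 'rV[K]_(dim M) -> K,
    (forall i, model_regular (chart_image c V) (a i)) /\
    forall W f, open W -> W `<=` V `&` chart_dom c -> regular W f ->
      forall x, W x -> X f x = \sum_i a i (c x) * partial c i f x.

Definition eq_on V X Y : Prop :=
  forall W f, open W -> W `<=` V -> regular W f ->
    forall x, W x -> X f x = Y f x.

Definition vf_bracket X Y : operator := fun f x => X (Y f) x - Y (X f) x.

Definition vf_comb k (a : 'I_k -> M -> K) (X : 'I_k -> operator) : operator :=
  fun f x => \sum_i a i x * X i f x.

(* The sections Y of S over V are locally combinations of X_1, ..., X_k with
   regular coefficients, for every open subset V of U: the X_i generate S|_U
   as a sheaf of modules. *)
Definition generators (S : set M -> operator -> Prop) U k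
    (X : 'I_k -> operator) : Prop :=
  (forall i, S U (X i)) /\
  forall V Y, open V -> V `<=` U -> S V Y -> forall x, V x ->
    exists W (a : 'I_k -> M -> K),
      [/\ open W, W x, W `<=` V, forall i, regular W (a i) &
          eq_on W Y (vf_comb a X)].

Definition generated_near (S : set M -> operator -> Prop) (m : M) (k : nat) :
    Prop :=
  exists U (X : 'I_k -> operator), [/\ open U, U m & generators S U X].

Record singular_foliation := SingularFoliation {
  fol :> set M -> operator -> Prop;
  fol_vector_field : forall V X, open V -> fol V X -> vector_field V X;
  fol_eq : forall V X Y, open V -> eq_on V X Y -> fol V X -> fol V Y;
  fol_restr : forall V W X, open V -> open W -> W `<=` V -> fol V X -> fol W X;
  fol_glue : forall V X, open V -> vector_field V X ->
    (forall x, V x -> exists W, [/\ open W, W x, W `<=` V & fol W X]) ->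
    fol V X;
  fol_zero : forall V, open V -> fol V (fun _ _ => 0);
  fol_add : forall V X Y, open V -> fol V X -> fol V Y ->
    fol V (fun f x => X f x + Y f x);
  fol_scale : forall V a X, open V -> regular V a -> fol V X ->
    fol V (fun f x => a x * X f x);
  fol_bracket : forall V X Y, open V -> fol V X -> fol V Y ->
    fol V (vf_bracket X Y);
  fol_finite : forall m : M, exists k, generated_near fol m k }.

Definition is_rank (F : singular_foliation) (m : M) (r : nat) : Prop :=
  generated_near F m r /\ forall k, generated_near F m k -> (r <= k)%N.

Record trivialization (fiber : M -> lmodType K) (r : nat) := Trivialization {
  triv_dom : set M;
  triv_map : forall x, {linear fiber x -> 'rV[K]_r};
  triv_inv : forall x, 'rV[K]_r -> fiber x }.

Structure vector_bundle U (r : nat) := VectorBundle {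
  fiber : M -> lmodType K;
  triv_atlas : set (trivialization fiber r);
  triv_open : forall t, triv_atlas t -> open (triv_dom t);
  triv_sub : forall t, triv_atlas t -> triv_dom t `<=` U;
  triv_mapK : forall t x, triv_atlas t -> triv_dom t x ->
    cancel (triv_map t x) (triv_inv t x);
  triv_invK : forall t x, triv_atlas t -> triv_dom t x ->
    cancel (triv_inv t x) (triv_map t x);
  triv_cover : forall x, U x -> exists2 t, triv_atlas t & triv_dom t x;
  triv_transition : forall s t, triv_atlas s -> triv_atlas t -> forall i j,
    regular (triv_dom s `&` triv_dom t)
      (fun x => triv_map t x (triv_inv s x (basis_vector K i)) 0 j) }.

(* s is an element of Gamma(V, A) *)
Definition is_section U r (A : vector_bundle U r) V
    (s : forall x, fiber A x) : Prop :=
  forall t, triv_atlas t -> forall j,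
    regular (V `&` triv_dom t) (fun x => triv_map t x (s x) 0 j).

(* The anchor sends v in A_x to the tangent vector f |-> anchor v f at x; it is
   a morphism of vector bundles: linear on the fibres, and sending regular
   sections to regular vector fields.  The bracket is a bracket on the sheaf of
   sections over open subsets of U; that the anchor preserves brackets follows
   from the Jacobi and Leibniz identities. *)
Record lie_algebroid U (r : nat) := LieAlgebroid {
  bundle :> vector_bundle U r;
  anchor : forall x, fiber bundle x -> (M -> K) -> K;
  bracket : (forall x, fiber bundle x) -> (forall x, fiber bundle x) ->
    forall x, fiber bundle x;
  anchor_linear : forall x W f (a : K) (v w : fiber bundle x),
    U x -> open W -> W x -> regular W f ->
    anchor (a *: v + w) f = a * anchor v f + anchor w f;
  anchor_regular : forall V s, open V -> V `<=` U -> is_section V s ->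
    vector_field V (fun f x => anchor (s x) f);
  bracket_section : forall V s t, open V -> V `<=` U ->
    is_section V s -> is_section V t -> is_section V (bracket s t);
  bracket_local : forall V s s' t t', open V -> V `<=` U ->
    is_section V s -> is_section V t ->
    (forall x, V x -> s x = s' x) -> (forall x, V x -> t x = t' x) ->
    forall x, V x -> bracket s t x = bracket s' t' x;
  bracket_linear : forall V (a : K) s t u, open V -> V `<=` U ->
    is_section V s -> is_section V t -> is_section V u -> forall x, V x ->
    bracket (fun y => a *: s y + t y) u x = a *: bracket s u x + bracket t u x;
  bracket_anticomm : forall V s t, open V -> V `<=` U ->
    is_section V s -> is_section V t -> forall x, V x ->
    bracket s t x = - bracket t s x;
  bracket_jacobi : forall V s t u, open V -> V `<=` U ->
    is_section V s -> is_section V t -> is_section V u -> forall x, V x ->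
    bracket s (bracket t u) x + bracket t (bracket u s) x
      + bracket u (bracket s t) x = 0;
  bracket_leibniz : forall V f s t, open V -> V `<=` U -> regular V f ->
    is_section V s -> is_section V t -> forall x, V x ->
    bracket s (fun y => f y *: t y) x =
      f x *: bracket s t x + anchor (s x) f *: t x }.

Definition anchor_field U r (A : lie_algebroid U r) (s : forall x, fiber A x) :
  operator := fun f x => anchor (s x) f.

(* rho(Gamma(A)) = F|_U, where rho(Gamma(A)) is the image sheaf *)
Definition induces U r (A : lie_algebroid U r) (F : singular_foliation) : Prop :=
  forall V X, open V -> V `<=` U ->
    (F V X <-> vector_field V X /\
       forall x, V x -> exists W (s : forall y, fiber A y),
         [/\ open W, W x, W `<=` V, is_section W s &
             eq_on W X (anchor_field s)]).

End Manifolds.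

(* Main.v *)
(* On K^3 let Z = d/dx_0 and let F consist of the vector fields a Z with a in
   the ideal (q_0, q_1, q_2), where q_l = x_l^2.  F is involutive because
   [a Z, b Z] = (a Z(b) - b Z(a)) Z, and the q_l Z are minimal generators at 0:
   if sum a_l q_l = 0, then the a_l vanish at 0 together with their first
   derivatives, as one sees along the l-th axis, where only q_l is nonzero.

   Let e_0, e_1, e_2 be a frame of a Lie algebroid of rank 3 inducing F near 0,
   with anchor rho(e_i) = g_i Z and structure functions c_ij^k.  Then
   g_i = sum_l h_il q_l with H = h(0) invertible.  Since rho preserves brackets,
   c_ij^k - (delta_ik Z(g_j) - delta_jk Z(g_i)) is a syzygy of (g_k), hence
   vanishes to second order at 0.  This determines the 1-jet of c at 0: c and
   d_2 c vanish there, and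
     Z(c_ij^k)(0) = 2 (delta_ik H_j0 - delta_jk H_i0).
   The Jacobi identity reads
     sum_cyc (sum_l c_ij^l c_kl^m + g_k Z(c_ij^m)) = 0,
   and applying d_2 twice at 0 leaves sum_cyc 2 H_k2 Z(c_ij^m)(0) = 0, that is,
   the columns 0 and 2 of H are parallel, a contradiction.

   The argument only uses that regular functions form a ring with constants and
   coordinates, stable under partial derivatives.  For analytic functions this
   is proved on power series, whose coefficients are bounded geometrically. *)

Require Import Defs.
From mathcomp Require Import all_boot all_order all_algebra.
From mathcomp Require Import complex.
From mathcomp Require Import all_classical all_reals all_analysis.
From mathcomp Require Import ring.
Set Implicit Arguments.
Unset Strict Implicit.
Unset Printing Implicit Defensive.
Import Order.TTheory GRing.Theory Num.Theory.
Import numFieldNormedType.Exports.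
Local Open Scope classical_set_scope.
Local Open Scope ring_scope.

(** * Partial derivatives of regular functions *)

Definition pder (K : numFieldType) n (i : 'I_n) (f : 'rV[K]_n -> K) : 'rV[K]_n -> K :=
  fun x => 'D_(basis_vector K i) (f : _ -> K^o) x.

(** The common interface to the three sheaves of functions. [reg_ext] is an axiom because functions
    are total and only their values on [U] count. *)
Record calculus (K : numFieldType) n
    (P : set 'rV[K]_n -> ('rV[K]_n -> K) -> Prop) : Prop := Calculus {
  reg_ext : forall U f g, open U -> (forall x, U x -> f x = g x) ->
    P U f -> P U g;
  reg_sub : forall U V f, open U -> open V -> V `<=` U -> P U f -> P V f;
  reg_cst : forall U a, open U -> P U (fun=> a);
  reg_coord : forall U i, open U -> P U (fun x => x 0 i);
  reg_add : forall U f g, open U -> P U f -> P U g -> P U (fun x => f x + g x);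
  reg_mul : forall U f g, open U -> P U f -> P U g -> P U (fun x => f x * g x);
  reg_derivable : forall U f i x, open U -> P U f -> U x ->
    derivable (f : _ -> K^o) x (basis_vector K i);
  reg_pder : forall U f i, open U -> P U f -> P U (pder i f) }.

Arguments reg_derivable {K n P} _ {U f} i {x} _ _ _.

(** Restricted to the line through [x] in direction [v], [f] is a differentiable function of one
    variable, hence continuous. *)
Lemma derivable_cvg0 (K : numFieldType) (V : normedModType K) (f : V -> K^o) x v :
  derivable f x v -> (fun t : K => f (t *: v + x)) @ 0^' --> f x.
Proof.
move=> /derivable1P/derivable1_diffP/differentiable_continuous.
rewrite /prop_for /continuous_at scale0r add0r => h.
by apply: cvg_trans h; apply: cvg_app; exact: cvg_within.
Qed.

Lemma is_derive_coord (K : numFieldType) n (i j : 'I_n) (x : 'rV[K]_n) :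
  is_derive x (basis_vector K i) (fun y : 'rV[K]_n => y 0 j : K^o) (i == j)%:R.
Proof.
have lin : (h^-1 *: (((fun y : 'rV[K]_n => y 0 j : K^o) \o shift x)
    (h *: basis_vector K i) - x 0 j)) @[h --> (0 : K)^'] --> ((i == j)%:R : K^o).
  apply: (@cvg_trans _ ((fun=> (i == j)%:R) @ (0 : K)^')); last exact: cvg_cst.
  apply: near_eq_cvg; near=> h.
  rewrite /= !mxE eqxx /= addrK eq_sym /GRing.scale /= mulKf //.
  by near: h; exact: nbhs_dnbhs_neq.
by split; [apply/cvg_ex; eexists; exact: lin|apply: cvg_lim lin].
Unshelve. all: end_near. Qed.

Section Calculus.
Variables (K : numFieldType) (n : nat).
Variable P : set 'rV[K]_n -> ('rV[K]_n -> K) -> Prop.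
Hypothesis calcP : calculus P.
Implicit Types (U W : set 'rV[K]_n) (f g : 'rV[K]_n -> K).

Lemma reg_opp U f : open U -> P U f -> P U (fun x => - f x).
Proof.
move=> oU Pf; apply: (reg_ext calcP oU (f := fun x => (-1) * f x)).
  by move=> x _; rewrite mulN1r.
by apply: reg_mul => //; exact: reg_cst.
Qed.

Lemma reg_subr U f g : open U -> P U f -> P U g -> P U (fun x => f x - g x).
Proof. by move=> oU Pf Pg; apply: reg_add => //; exact: reg_opp. Qed.

Lemma reg_sum U (I : Type) (r : seq I) (F : I -> 'rV[K]_n -> K) : open U ->
  (forall i, P U (F i)) -> P U (fun x => \sum_(i <- r) F i x).
Proof.
move=> oU PF; elim: r => [|i r IH].
  apply: (reg_ext calcP oU (f := fun=> 0)); last exact: reg_cst.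
  by move=> x _; rewrite big_nil.
apply: (reg_ext calcP oU (f := fun x => F i x + \sum_(j <- r) F j x)).
  by move=> x _; rewrite big_cons.
exact: reg_add.
Qed.

Lemma pder_ext U f g i x : open U -> U x -> (forall y, U y -> f y = g y) ->
  pder i f x = pder i g x.
Proof.
move=> oU Ux fg; apply: near_eq_derive.
by near=> y; apply: fg; near: y; exact: open_nbhs_nbhs.
Unshelve. all: end_near. Qed.

Lemma pder_cst (a : K) i (x : 'rV[K]_n) : pder i (fun=> a) x = 0.
Proof. by rewrite /pder derive_cst. Qed.

Lemma pder_add U f g i x : open U -> U x -> P U f -> P U g ->
  pder i (fun y => f y + g y) x = pder i f x + pder i g x.
Proof.
by move=> oU Ux Pf Pg; rewrite /pder -deriveD //; exact: (reg_derivable calcP i oU _ Ux).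
Qed.

Lemma pder_mul U f g i x : open U -> U x -> P U f -> P U g ->
  pder i (fun y => f y * g y) x = pder i f x * g x + f x * pder i g x.
Proof.
move=> oU Ux Pf Pg; rewrite /pder deriveM; [|exact: (reg_derivable calcP i oU _ Ux)..].
by rewrite addrC mulrC.
Qed.

Lemma pder_opp U f i x : open U -> U x -> P U f ->
  pder i (fun y => - f y) x = - pder i f x.
Proof. by move=> oU Ux Pf; rewrite /pder -deriveN //; exact: (reg_derivable calcP i oU _ Ux). Qed.

Lemma pder_subr U f g i x : open U -> U x -> P U f -> P U g ->
  pder i (fun y => f y - g y) x = pder i f x - pder i g x.
Proof.
move=> oU Ux Pf Pg; rewrite (pder_add _ oU Ux) ?(pder_opp _ oU Ux) //.
exact: reg_opp.
Qed.

Lemma pder_sum U (I : Type) (r : seq I) (F : I -> 'rV[K]_n -> K) i x :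
  open U -> U x -> (forall k, P U (F k)) ->
  pder i (fun y => \sum_(k <- r) F k y) x = \sum_(k <- r) pder i (F k) x.
Proof.
move=> oU Ux PF; elim: r => [|k r IH].
  by under eq_fun do rewrite big_nil; rewrite pder_cst big_nil.
under eq_fun do rewrite big_cons.
by rewrite (pder_add _ oU Ux) ?IH ?big_cons //; exact: reg_sum.
Qed.

Lemma pder_coord (i j : 'I_n) (x : 'rV[K]_n) :
  pder i (fun y => y 0 j) x = (i == j)%:R.
Proof. by have [_] := is_derive_coord i j x. Qed.

Definition sq (l : 'I_n) (x : 'rV[K]_n) : K := x 0 l ^+ 2.

Lemma reg_sq U l : open U -> P U (sq l).
Proof.
move=> oU; apply: (reg_ext calcP oU (f := fun x => x 0 l * x 0 l)).
  by move=> x _; rewrite -expr2.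
by apply: reg_mul => //; exact: reg_coord.
Qed.

Lemma pder_sq i l x : pder i (sq l) x = (i == l)%:R * (2 * x 0 l).
Proof.
rewrite (_ : sq l = fun y => y 0 l * y 0 l); last first.
  by apply/funext => y; rewrite -expr2.
have PC := reg_coord calcP l openT.
rewrite (pder_mul _ openT _ PC PC) // !pder_coord; ring.
Qed.

Lemma pder2_sq i j l x : pder j (pder i (sq l)) x = 2 * (i == l)%:R * (j == l)%:R.
Proof.
rewrite (_ : pder i (sq l) = fun y => ((i == l)%:R * 2) * y 0 l); last first.
  by apply/funext => y; rewrite pder_sq mulrA.
rewrite (pder_mul _ openT _ (reg_cst calcP _ openT) (reg_coord calcP l openT)) //.
rewrite pder_cst pder_coord; ring.
Qed.

(** Since the 1-jet of [f] vanishes at [x], the only surviving Leibniz term has both derivatives on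
    [f]. *)
Lemma pder2_mul U f g i j x : open U -> U x -> P U f -> P U g ->
  f x = 0 -> pder i f x = 0 -> pder j f x = 0 ->
  pder j (pder i (fun y => f y * g y)) x = pder j (pder i f) x * g x.
Proof.
move=> oU Ux Pf Pg f0 fi0 fj0.
have Pfi := reg_pder calcP i oU Pf; have Pgi := reg_pder calcP i oU Pg.
rewrite (pder_ext j (g := fun y => pder i f y * g y + f y * pder i g y) oU Ux); last first.
  by move=> y Uy; rewrite (pder_mul i oU Uy).
rewrite (pder_add j oU Ux) ?(pder_mul j oU Ux) ?f0 ?fi0 ?fj0 ?mul0r ?addr0 //.
  exact: reg_mul.
exact: reg_mul.
Qed.

Lemma pder2_add U f g i j x : open U -> U x -> P U f -> P U g ->
  pder j (pder i (fun y => f y + g y)) x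
    = pder j (pder i f) x + pder j (pder i g) x.
Proof.
move=> oU Ux Pf Pg.
rewrite (pder_ext j (g := fun y => pder i f y + pder i g y) oU Ux); last first.
  by move=> y Uy; rewrite (pder_add i oU Uy).
by rewrite (pder_add j oU Ux) //; exact: reg_pder.
Qed.

Lemma pder2_sum U (I : Type) (r : seq I) (F : I -> 'rV[K]_n -> K) i j x :
  open U -> U x -> (forall k, P U (F k)) ->
  pder j (pder i (fun y => \sum_(k <- r) F k y)) x
    = \sum_(k <- r) pder j (pder i (F k)) x.
Proof.
move=> oU Ux PF.
rewrite (pder_ext j (g := fun y => \sum_(k <- r) pder i (F k) y) oU Ux); last first.
  by move=> y Uy; rewrite (pder_sum _ i oU Uy).
by rewrite (pder_sum _ j oU Ux) // => k; exact: reg_pder.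
Qed.

(** Continuity along the axis extends the vanishing to the origin. The origin is excluded from the
    hypothesis because a factor [t ^+ 2] has to be cancelled on the axis. *)
Lemma reg_eq0_axis U f l : open U -> U 0 -> P U f ->
  (forall t : K, t != 0 -> U (t *: basis_vector K l) ->
     f (t *: basis_vector K l) = 0) -> f 0 = 0.
Proof.
move=> oU U0 Pf fax.
have /derivable_cvg0 := reg_derivable calcP l oU Pf U0.
move=> /(@cvg_unique K _); apply; first exact: norm_hausdorff.
apply: (@cvg_trans _ ((fun=> 0) @ (0 : K)^')); last exact: cvg_cst.
apply: near_eq_cvg; near=> t.
rewrite addr0 fax //.
  by near: t; exact: nbhs_dnbhs_neq.
near: t; apply: cvg_within.
have : (fun t : K => t *: basis_vector K l) @ 0 --> (0 : 'rV[K]_n).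
  rewrite -[X in _ --> X](scale0r (basis_vector K l)).
  have id0 : (fun t : K => t) @ (0 : K) --> (0 : K) by move=> A.
  exact: cvgZr_tmp id0.
by apply; exact: open_nbhs_nbhs.
Unshelve. all: end_near. Qed.

(* On the l-th axis only the l-th square survives. *)
Lemma sq_syzygy U (a : 'I_n -> 'rV[K]_n -> K) : open U -> U 0 ->
  (forall l, P U (a l)) -> (forall x, U x -> \sum_l a l x * sq l x = 0) ->
  forall l, a l 0 = 0 /\ forall j, pder j (a l) 0 = 0.
Proof.
move=> oU U0 Pa sum0 l.
have sqax (t : K) k : sq k (t *: basis_vector K l) = (k == l)%:R * t ^+ 2.
  rewrite /sq !mxE eqxx /= exprMn mulrC eq_sym.
  by case: eqP; rewrite ?mulr0n ?expr1n // expr0n !mul0r.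
have aax (t : K) : t != 0 -> U (t *: basis_vector K l) ->
    a l (t *: basis_vector K l) = 0.
  move=> t0 /sum0; rewrite (bigD1 l) //= big1 ?addr0; last first.
    by move=> k /negPf kl; rewrite sqax kl mul0r mulr0.
  rewrite sqax eqxx mul1r => /eqP; rewrite mulf_eq0 expf_eq0 (negPf t0) andbF orbF.
  by move/eqP.
split; first exact: reg_eq0_axis aax.
move=> j; apply: (reg_eq0_axis oU U0 (l := l)); first exact: reg_pder.
move=> t t0 Ut.
(* Differentiate the relation, then restrict to the axis: for k != l both [sq k] and its derivatives
   vanish there, and for k = l the derivative of [sq l] is multiplied by [a l], which is already 0
   there. *)
have : pder j (fun x => \sum_k a k x * sq k x) (t *: basis_vector K l) = 0.
  by rewrite (pder_ext j (g := fun=> 0) oU Ut) // pder_cst.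
rewrite (pder_sum _ j oU Ut); last by move=> k; apply: reg_mul => //; exact: reg_sq.
under eq_bigr => k _ do rewrite (pder_mul j oU Ut (Pa k) (reg_sq k oU)) pder_sq sqax.
rewrite (bigD1 l) //= big1 ?addr0; last first.
  move=> k /negPf kl; rewrite kl !mul0r mulr0 add0r !mxE eqxx kl /=.
  by rewrite !mulr0.
rewrite aax // mul0r addr0 eqxx mul1r => /eqP.
by rewrite mulf_eq0 expf_eq0 (negPf t0) andbF orbF => /eqP.
Qed.

End Calculus.

(** * The Jacobi identity at the origin *)

Section Obstruction.
Variables (K : numFieldType) (n : nat).
Variable P : set 'rV[K]_n -> ('rV[K]_n -> K) -> Prop.
Hypothesis calcP : calculus P.
Variables (W : set 'rV[K]_n) (o z : 'I_n).
Variables (h : 'I_n -> 'I_n -> 'rV[K]_n -> K)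
  (c : 'I_n -> 'I_n -> 'I_n -> 'rV[K]_n -> K) (H' : 'I_n -> 'I_n -> K).
Hypotheses (n_gt2 : (2 < n)%N) (oz : o != z) (oW : open W) (W0 : W 0).
Hypothesis Ph : forall i l, P W (h i l).
Hypothesis Pc : forall i j k, P W (c i j k).

Let H (i l : 'I_n) : K := h i l 0.
Let g i (x : 'rV[K]_n) : K := \sum_l h i l x * sq l x.

Hypothesis H'H : forall l m, \sum_i H' l i * H i m = (l == m)%:R.

(* c is the matrix of structure functions of a frame e with anchor
   rho(e_i) = g_i d/dx_o : the first condition says that rho preserves
   brackets, the second one is the e_m component of the Jacobi identity. *)
Hypothesis bracketE : forall i j x, W x ->
  g i x * pder o (g j) x - g j x * pder o (g i) x = \sum_k c i j k x * g k x.
Let jac i j k m (x : 'rV[K]_n) : K :=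
  \sum_l c i j l x * c k l m x + g k x * pder o (c i j m) x.
Hypothesis jacobi : forall i j k m x, W x ->
  jac i j k m x + jac j k i m x + jac k i j m x = 0.

(** A left inverse of a square matrix is also a right inverse. *)
Let HH' k m : \sum_l H k l * H' l m = (k == m)%:R.
Proof.
pose A := \matrix_(l, i) H' l i; pose B := \matrix_(i, l) H i l.
have AB : A *m B = 1%:M.
  apply/matrixP => l l'; rewrite !mxE -H'H.
  by apply: eq_bigr => i _; rewrite !mxE.
have /matrixP/(_ k m) := mulmx1C AB; rewrite !mxE => <-.
by apply: eq_bigr => i _; rewrite !mxE.
Qed.

Let inj0 (v : 'I_n -> K) : (forall l, \sum_k v k * H k l = 0) ->
  forall m, v m = 0.
Proof.
move=> vH m.
have -> : v m = \sum_k v k * \sum_l H k l * H' l m.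
  under eq_bigr => k _ do rewrite HH'.
  rewrite (bigD1 m) //= eqxx mulr1 big1 ?addr0 // => k /negPf ->.
  by rewrite mulr0.
under eq_bigr => k _ do rewrite mulr_sumr.
rewrite exchange_big /= big1 // => l _.
by under eq_bigr => k _ do rewrite mulrA; rewrite -mulr_suml vH mul0r.
Qed.

Let Psq l : P W (sq l). Proof. exact: reg_sq. Qed.
Let Phsq i l : P W (fun x => sq l x * h i l x). Proof. exact: reg_mul. Qed.

(** The square is put first so that [pder2_mul] applies to the factor whose 1-jet vanishes at 0. *)
Let gE i : g i = fun x => \sum_l sq l x * h i l x.
Proof. by apply/funext => x; apply: eq_bigr => l _; rewrite mulrC. Qed.

Let Pg i : P W (g i).
Proof. by rewrite gE; apply: reg_sum. Qed.

Let g0 i : g i 0 = 0.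
Proof. by rewrite /g big1 // => l _; rewrite /sq mxE expr0n mulr0. Qed.

Let sq0 l : sq l (0 : 'rV[K]_n) = 0.
Proof. by rewrite /sq mxE expr0n. Qed.

Let Dsq0 j l : pder j (sq l) (0 : 'rV[K]_n) = 0.
Proof. by rewrite (pder_sq calcP) mxE !mulr0. Qed.

Let Dg0 i j : pder j (g i) 0 = 0.
Proof.
rewrite gE (pder_sum calcP _ _ oW W0) // big1 // => l _.
by rewrite (pder_mul calcP _ oW W0) // sq0 Dsq0 !mul0r addr0.
Qed.

Let DDg0 i j k : pder k (pder j (g i)) 0 = 2 * (j == k)%:R * H i j.
Proof.
rewrite gE (pder2_sum calcP _ _ _ oW W0) // (bigD1 j) //= big1.
  rewrite (pder2_mul calcP oW W0) ?(pder2_sq calcP) // eqxx (eq_sym k) addr0.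
  by rewrite mulr1.
move=> l /negPf jl.
by rewrite (pder2_mul calcP oW W0) ?(pder2_sq calcP) // eq_sym jl mulr0 !mul0r.
Qed.

Let t i j k x :=
  c i j k x - ((i == k)%:R * pder o (g j) x - (j == k)%:R * pder o (g i) x).

Let Pcst a : P W (fun=> a). Proof. exact: reg_cst. Qed.
Let PDg j i : P W (pder j (g i)). Proof. exact: reg_pder. Qed.
Let Pt' i j k :
  P W (fun x => (i == k)%:R * pder o (g j) x - (j == k)%:R * pder o (g i) x).
Proof. by apply: reg_subr => //; apply: reg_mul. Qed.
Let Pt i j k : P W (t i j k). Proof. exact: reg_subr. Qed.

Let tg i j x : W x -> \sum_k t i j k x * g k x = 0.
Proof.
move=> Wx; rewrite /t; under eq_bigr do rewrite mulrBl.
rewrite sumrB -bracketE //; apply/eqP; rewrite subr_eq0; apply/eqP.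
under eq_bigr do rewrite mulrBl.
rewrite sumrB (bigD1 i) //= eqxx mul1r big1 ?addr0; last first.
  by move=> k /negPf ki; rewrite eq_sym ki !mul0r.
rewrite (bigD1 j) //= eqxx mul1r big1 ?addr0; last first.
  by move=> k /negPf ki; rewrite eq_sym ki !mul0r.
by rewrite mulrC; congr (_ - _); rewrite mulrC.
Qed.

(** Expanding each [g k] in squares turns the syzygy [tg] into one of the squares, with coefficients
    [a l], whose 1-jets vanish by [sq_syzygy]. Invertibility of [H] transfers this to [t]: first the
    values, then the derivatives, where the terms differentiating [h] carry a factor
    [t i j k' 0 = 0]. *)
Let t_flat i j k : t i j k 0 = 0 /\ forall l, pder l (t i j k) 0 = 0.
Proof.
pose a l (x : 'rV[K]_n) : K := \sum_k t i j k x * h k l x.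
have Pth k' l : P W (fun x => t i j k' x * h k' l x) by apply: reg_mul.
have Pa l : P W (a l) by apply: reg_sum.
have as0 x : W x -> \sum_l a l x * sq l x = 0.
  move=> Wx; rewrite -[RHS](tg i j Wx) /a.
  under eq_bigr do rewrite mulr_suml.
  rewrite exchange_big /=; apply: eq_bigr => k' _; rewrite /g mulr_sumr.
  by apply: eq_bigr => l _; rewrite mulrA.
have t0 k' : t i j k' 0 = 0.
  by move: k'; apply: inj0 => l; have [+ _] := sq_syzygy calcP oW W0 Pa as0 l.
split=> // l; move: k; apply: inj0 => m.
have [_ /(_ l)] := sq_syzygy calcP oW W0 Pa as0 m.
rewrite /a (pder_sum calcP _ _ oW W0) // => e; rewrite -[RHS]e.
apply: eq_bigr => k' _; by rewrite (pder_mul calcP _ oW W0) // t0 mul0r addr0.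
Qed.

Let c0 i j k : c i j k 0 = 0.
Proof.
have [+ _] := t_flat i j k.
by rewrite /t !Dg0 !mulr0 !subr0.
Qed.

(** By flatness of [t], [c] has the 1-jet of the terms subtracted in [t], so its derivatives are
    second derivatives of the [g i]. *)
Let Dc0 i j k l : pder l (c i j k) 0 =
  2 * (o == l)%:R * ((i == k)%:R * H j o - (j == k)%:R * H i o).
Proof.
have [_ /(_ l)] := t_flat i j k.
rewrite /t (pder_subr calcP _ oW W0) // => /eqP; rewrite subr_eq0 => /eqP ->.
have PM (a : K) i' : P W (fun x => a * pder o (g i') x) by apply: reg_mul.
rewrite (pder_subr calcP _ oW W0) //.
rewrite !(pder_mul calcP _ oW W0) // !pder_cst !DDg0; ring.
Qed.

(** The quadratic terms drop out, since [c] and, as o != z, its [z]-derivative vanish at 0. In the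
    last term the 1-jet of [g k] vanishes, so both derivatives fall on [g k] and give 2 H_kz,
    against the value [Dc0] of the other factor. *)
Let DDjac i j k m : pder z (pder z (jac i j k m)) 0 =
  4 * H k z * ((i == m)%:R * H j o - (j == m)%:R * H i o).
Proof.
have Pcc l : P W (fun x => c i j l x * c k l m x) by apply: reg_mul.
have PDc : P W (pder o (c i j m)) by apply: reg_pder.
have Dz0 i' j' k' : pder z (c i' j' k') 0 = 0.
  by rewrite Dc0 (negPf oz) mulr0 mul0r.
rewrite /jac (pder2_add calcP _ _ oW W0); [|exact: reg_sum|exact: reg_mul].
rewrite (pder2_sum calcP _ _ _ oW W0) // big1 ?add0r; last first.
  by move=> l _; rewrite (pder2_mul calcP oW W0) // c0 mulr0.
rewrite (pder2_mul calcP oW W0) // DDg0 Dc0 !eqxx !mulr1; ring.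
Qed.

(** Take the Jacobi identity for i, j, k in the component m = i, with i different from j and k: of
    the six terms given by [DDjac] only the two of this minor remain. *)
Let minor j k : H j o * H k z = H k o * H j z.
Proof.
have [->|jk] := eqVneq j k; first by rewrite mulrC.
(* A third index exists because [2 < n]. *)
have [i ij ik] : exists2 i : 'I_n, i != j & i != k.
  have : ~~ ('I_n \subset pred2 j k).
    apply/negP => /subset_leq_card; rewrite card_ord card2 jk.
    by rewrite leqNgt n_gt2.
  by case/subsetPn => i _; rewrite !inE negb_or => /andP[]; exists i.
have PJ i' j' k' m : P W (jac i' j' k' m).
  rewrite /jac; apply: reg_add => //; last by apply: reg_mul => //; exact: reg_pder.
  by apply: reg_sum => // l; exact: reg_mul.
have add3 F1 F2 F3 : P W F1 -> P W F2 -> P W F3 -> forall v1 v2 v3,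
    pder z (pder z F1) 0 = v1 -> pder z (pder z F2) 0 = v2 ->
    pder z (pder z F3) 0 = v3 ->
    pder z (pder z (fun x => F1 x + F2 x + F3 x)) 0 = v1 + v2 + v3.
  move=> P1 P2 P3 _ _ _ <- <- <-; rewrite -(pder2_add calcP _ _ oW W0 P1 P2).
  by rewrite -(pder2_add calcP _ _ oW W0 (reg_add calcP oW P1 P2) P3).
have : pder z (pder z (fun x => jac i j k i x + jac j k i i x + jac k i j i x)) 0 = 0.
  rewrite (pder_ext z (g := pder z (fun=> 0)) oW W0).
    by rewrite (pder_ext z (g := fun=> 0) oW W0) ?pder_cst // => *; rewrite pder_cst.
  by move=> y Wy; apply: (pder_ext z oW Wy) => x Wx; exact: jacobi.
rewrite (add3 _ _ _ (PJ i j k i) (PJ j k i i) (PJ k i j i) _ _ _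
  (DDjac i j k i) (DDjac j k i i) (DDjac k i j i)).
rewrite (eqxx i) !(eq_sym _ i) (negPf ij) (negPf ik) !mulr1n !mulr0n => e.
have : 4 * (H j o * H k z - H k o * H j z) = 0 by rewrite -[RHS]e; ring.
by move/eqP; rewrite mulf_eq0 pnatr_eq0 /= subr_eq0 => /eqP.
Qed.

(** Write 1 as the product of the (o,o) and (z,z) entries of H'H. Exchanging the columns o and z by
    [minor] turns it into the product of the (o,z) and (z,o) entries, which is 0. *)
Lemma no_jacobi : False.
Proof.
have /eqP := oner_neq0 K; apply.
have one l : 1 = \sum_i H' l i * H i l by rewrite H'H eqxx.
have -> : (1 : K) = (\sum_i H' o i * H i o) * (\sum_i H' z i * H i z).
  by rewrite -!one mulr1.
transitivity ((\sum_i H' o i * H i z) * (\sum_i H' z i * H i o)); last first.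
  by rewrite !H'H (negPf oz) mul0r.
rewrite !mulr_suml; apply: eq_bigr => i _; rewrite !mulr_sumr.
apply: eq_bigr => j _; rewrite mulrACA minor [RHS]mulrACA.
by congr (_ * _); rewrite mulrC.
Qed.

End Obstruction.

(** * The foliation *)

Section Affine.
Variables (O : function_theory) (n : nat).
Local Notation K := (scalars O).
Local Notation P := (@model_regular O n).
Hypothesis calcP : calculus P.
Hypothesis scK : @second_countable 'rV[K]_n.

(** * Affine space as a manifold with one chart *)

Definition id_chart : chart O 'rV[K]_n n := @Chart O 'rV[K]_n n setT id id.

Lemma id_chart_image (V : set 'rV[K]_n) : chart_image id_chart V = V.
Proof. by rewrite /chart_image /= setIT image_id. Qed.

Lemma id_chart_is_chart : is_chart id_chart.
Proof.
split => //=; first exact: openT.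
  by move=> x _; exact: cvg_id.
by move=> V oV; rewrite id_chart_image.
Qed.

Lemma id_chart_transition (c d : chart O 'rV[K]_n n) :
  [set id_chart] c -> [set id_chart] d -> forall j,
  P (chart_image c (chart_dom d)) (fun y => d (chart_inv c y) 0 j).
Proof.
move=> -> -> j; rewrite id_chart_image /=.
by apply: reg_coord => //; exact: openT.
Qed.

Definition affine_space : manifold O.
refine (@Manifold O 'rV[K]_n n [set id_chart] _ scK _ _ id_chart_transition).
- exact: norm_hausdorff.
- by move=> c ->; exact: id_chart_is_chart.
- by move=> x; exists id_chart.
Defined.

Local Notation M := affine_space.
Implicit Types (U V W : set M) (f : M -> K) (X Y : operator M).

Lemma regularE V f : regular V f <-> P V f.
Proof.
split=> [/(_ id_chart erefl)|Pf c ->]; first by rewrite id_chart_image.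
by rewrite id_chart_image.
Qed.

Lemma vector_fieldE V X : vector_field V X <->
  exists a : 'I_n -> M -> K, (forall i, P V (a i)) /\
    forall W f, open W -> W `<=` V -> P W f ->
      forall x, W x -> X f x = \sum_i a i x * pder i f x.
Proof.
split=> [/(_ id_chart erefl)|] [a [Pa Xa]]; last move=> c ->.
  exists a; split; first by move=> i; have := Pa i; rewrite id_chart_image.
  move=> W f oW WV Pf x Wx; apply: (Xa W) => //; first by rewrite setIT.
  exact/regularE.
exists a; split; first by move=> i; rewrite id_chart_image.
move=> W f oW; rewrite setIT => WV /regularE Pf x Wx.
exact: (Xa W).
Qed.

(** * The multiples of one coordinate field by the ideal of squares *)

Definition along (o : 'I_n) V (a : M -> K) X :=
  forall W f, open W -> W `<=` V -> P W f ->
    forall x, W x -> X f x = a x * pder o f x.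

(** Membership is local, with coefficients allowed to change from point to point: this is the ideal
    sheaf generated by the squares, and it makes gluing possible. *)
Definition in_ideal V (a : M -> K) :=
  forall x, V x -> exists W (b : 'I_n -> M -> K),
    [/\ open W, W x, W `<=` V, forall l, P W (b l) &
        forall y, W y -> a y = \sum_l b l y * sq l y].

Variable o : 'I_n.

Definition squares_fol V X :=
  exists a, [/\ P V a, along o V a X & in_ideal V a].

Lemma along_vector_field V a X : P V a -> along o V a X -> open V ->
  vector_field V X.
Proof.
move=> Pa Xa oV; apply/vector_fieldE.
exists (fun i x => (i == o)%:R * a x); split.
  by move=> i; apply: reg_mul => //; exact: reg_cst.
move=> W f oW WV Pf x Wx; rewrite (Xa W f) // (bigD1 o) //= eqxx mul1r big1 ?addr0 //.
by move=> i /negPf ->; rewrite !mul0r.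
Qed.

(** Applying the field to the coordinate x_o recovers its coefficient, which is how coefficients of
    equal operators are compared. *)
Lemma along_coord V a X x : along o V a X -> open V -> V x ->
  X (fun y => y 0 o) x = a x.
Proof.
move=> Xa oV Vx; rewrite (Xa V (fun y => y 0 o)) //; last exact: reg_coord.
by rewrite pder_coord eqxx mulr1.
Qed.

Lemma in_ideal_sub V W a : open W -> W `<=` V -> in_ideal V a -> in_ideal W a.
Proof.
move=> oW WV aI x Wx; have [W' [b [oW' W'x W'V Pb ab]]] := aI x (WV _ Wx).
exists (W `&` W'), b; split => //; first exact: openI.
- by move=> l; apply: (reg_sub calcP) (Pb l) => //; exact: openI.
- by move=> y [_ W'y]; exact: ab.
Qed.

Lemma in_ideal_add V a b : in_ideal V a -> in_ideal V b ->
  in_ideal V (fun x => a x + b x).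
Proof.
move=> aI bI x Vx.
have [W [a' [oW Wx WV Pa aa]]] := aI x Vx.
have [W' [b' [oW' W'x W'V Pb bb]]] := bI x Vx.
have oWW := openI oW oW'.
exists (W `&` W'), (fun l y => a' l y + b' l y); split => //.
- by move=> y [Wy _]; exact: WV.
- move=> l; apply: reg_add => //.
    by apply: (reg_sub calcP) (Pa l).
  by apply: (reg_sub calcP) (Pb l).
- move=> y [Wy W'y]; rewrite aa ?bb // -big_split /=.
  by apply: eq_bigr => l _; rewrite mulrDl.
Qed.

Lemma in_ideal_scale V a b : open V -> P V b -> in_ideal V a ->
  in_ideal V (fun x => b x * a x).
Proof.
move=> oV Pb aI x Vx.
have [W [a' [oW Wx WV Pa aa]]] := aI x Vx.
exists W, (fun l y => b y * a' l y); split => //.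
- move=> l; apply: reg_mul => //; exact: (reg_sub calcP) Pb.
- move=> y Wy; rewrite aa // mulr_sumr.
  by apply: eq_bigr => l _; rewrite mulrA.
Qed.

(* With a = sum a_l q_l and b = sum b_l q_l, the terms of a b' - b a' in which
   the q_l are differentiated are a B - b A, where A = sum a_l q_l' and
   B = sum b_l q_l'. *)
Lemma in_ideal_bracket V a b : open V -> P V a -> P V b ->
  in_ideal V a -> in_ideal V b ->
  in_ideal V (fun x => a x * pder o b x - b x * pder o a x).
Proof.
move=> oV Pa Pb aI bI x Vx.
have [W1 [a' [oW1 W1x W1V Pa1 aa1]]] := aI x Vx.
have [W2 [b' [oW2 W2x W2V Pb2 bb2]]] := bI x Vx.
pose W := W1 `&` W2.
have oW : open W by exact: openI.
have WV : W `<=` V by move=> y [Wy _]; exact: W1V.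
have Pa' l : P W (a' l) by apply: (reg_sub calcP) (Pa1 l) => // y [].
have Pb' l : P W (b' l) by apply: (reg_sub calcP) (Pb2 l) => // y [].
have aa y : W y -> a y = \sum_l a' l y * sq l y by move=> [? _]; exact: aa1.
have bb y : W y -> b y = \sum_l b' l y * sq l y by move=> [_ ?]; exact: bb2.
have {}Pa : P W a by apply: (reg_sub calcP) Pa.
have {}Pb : P W b by apply: (reg_sub calcP) Pb.
have Psq l : P W (sq l) by exact: reg_sq.
have PDsq l : P W (pder o (sq l)) by exact: reg_pder.
have deriv (e' : 'I_n -> M -> K) e y : (forall l, P W (e' l)) ->
    (forall y, W y -> e y = \sum_l e' l y * sq l y) -> W y ->
    pder o e y = (\sum_l pder o (e' l) y * sq l y) + \sum_l e' l y * pder o (sq l) y.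
  move=> Pe' ee Wy; rewrite (pder_ext o oW Wy ee) (pder_sum calcP _ _ oW Wy).
    rewrite -big_split; apply: eq_bigr => l _.
    by rewrite (pder_mul calcP _ oW Wy).
  by move=> l; exact: reg_mul.
pose A y := \sum_l a' l y * pder o (sq l) y.
pose B y := \sum_l b' l y * pder o (sq l) y.
have PA : P W A by apply: reg_sum => // l; exact: reg_mul.
have PB : P W B by apply: reg_sum => // l; exact: reg_mul.
exists W, (fun l y => (a y * pder o (b' l) y - b y * pder o (a' l) y)
  + (a' l y * B y - b' l y * A y)); split => //.
- move=> l; apply: (reg_add calcP oW).
    by apply: (reg_subr calcP oW); apply: (reg_mul calcP oW) => //; exact: reg_pder.
  by apply: (reg_subr calcP oW); apply: (reg_mul calcP oW).
- move=> y Wy; rewrite (deriv b' b) // (deriv a' a) // -/(A y) -/(B y).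
  transitivity (a y * (\sum_l pder o (b' l) y * sq l y)
      - b y * (\sum_l pder o (a' l) y * sq l y)
      + ((\sum_l a' l y * sq l y) * B y - (\sum_l b' l y * sq l y) * A y)).
    by rewrite -aa // -bb //; ring.
  move: (A y) (B y) => Ay By.
  rewrite !mulr_sumr !mulr_suml -!sumrB -big_split /=.
  by apply: eq_bigr => l _; ring.
Qed.

Lemma squares_fol_restr V W X : open V -> open W -> W `<=` V ->
  squares_fol V X -> squares_fol W X.
Proof.
move=> oV oW WV [a [Pa Xa aI]]; exists a; split.
- exact: (reg_sub calcP) Pa.
- by move=> W' f oW' W'W Pf x W'x; apply: (Xa W') => //; exact: subset_trans WV.
- exact: in_ideal_sub aI.
Qed.

Lemma squares_fol_eq V X Y : open V -> eq_on V X Y -> squares_fol V X ->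
  squares_fol V Y.
Proof.
move=> oV XY [a [Pa Xa aI]]; exists a; split => // W f oW WV Pf x Wx.
rewrite -(XY W f) //; first exact: (Xa W).
exact/regularE.
Qed.

(** The coefficients of [X] are its values on the coordinates. Computed locally, those in directions
    other than [o] vanish, and the one in direction [o] agrees with the local coefficients, hence
    lies in the ideal. *)
Lemma squares_fol_glue V X : open V -> vector_field V X ->
  (forall x, V x -> exists W, [/\ open W, W x, W `<=` V & squares_fol W X]) ->
  squares_fol V X.
Proof.
move=> oV /vector_fieldE[a [Pa Xa]] loc.
have coord i x : V x -> X (fun y => y 0 i) x = a i x.
  move=> Vx; rewrite (Xa V (fun y => y 0 i)) //; last exact: reg_coord.
  rewrite (bigD1 i) //= pder_coord eqxx mulr1 big1 ?addr0 //.
  by move=> j /negPf ji; rewrite pder_coord ji mulr0.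
exists (a o); split => //.
- move=> W f oW WV Pf x Wx; rewrite (Xa W) // (bigD1 o) //= big1 ?addr0 //.
  move=> i /negPf io; rewrite -coord; last exact: WV.
  have [W' [oW' W'x W'V [b [Pb Xb _]]]] := loc x (WV _ Wx).
  rewrite (Xb W' (fun y => y 0 i)) //; last exact: reg_coord.
  by rewrite pder_coord eq_sym io mulr0 mul0r.
- move=> x Vx; have [W' [oW' W'x W'V [b [Pb Xb bI]]]] := loc x Vx.
  have [W [b' [oW Wx WW' Pb' bb]]] := bI x W'x.
  exists W, b'; split => //; first exact: subset_trans W'V.
  move=> y Wy; rewrite -bb // -(along_coord Xb) //; last exact: WW'.
  by rewrite coord //; apply: W'V; exact: WW'.
Qed.

Lemma squares_fol_zero V : open V -> squares_fol V (fun _ _ => 0).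
Proof.
move=> oV; exists (fun=> 0); split.
- exact: reg_cst.
- by move=> *; rewrite mul0r.
- move=> x Vx; exists V, (fun _ _ => 0); split => //.
    by move=> l; exact: reg_cst.
  by move=> y Vy; rewrite big1 // => l _; rewrite mul0r.
Qed.

Lemma squares_fol_add V X Y : open V -> squares_fol V X -> squares_fol V Y ->
  squares_fol V (fun f x => X f x + Y f x).
Proof.
move=> oV [a [Pa Xa aI]] [b [Pb Xb bI]]; exists (fun x => a x + b x); split.
- exact: reg_add.
- by move=> W f oW WV Pf x Wx; rewrite (Xa W f) // (Xb W f) // mulrDl.
- exact: in_ideal_add.
Qed.

Lemma squares_fol_scale V b X : open V -> regular V b -> squares_fol V X ->
  squares_fol V (fun f x => b x * X f x).
Proof.
move=> oV /regularE Pb [a [Pa Xa aI]]; exists (fun x => b x * a x); split.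
- exact: reg_mul.
- by move=> W f oW WV Pf x Wx; rewrite (Xa W f) // mulrA.
- exact: in_ideal_scale.
Qed.

(** The second-order term is symmetric in [a] and [b], so it cancels in the bracket. *)
Lemma along_comp V a b X Y W f x : along o V a X -> along o V b Y ->
  open V -> P V b -> open W -> W `<=` V -> P W f -> W x ->
  X (Y f) x = a x * (pder o b x * pder o f x + b x * pder o (pder o f) x).
Proof.
move=> Xa Yb oV Pb oW WV Pf Wx.
have YE y : W y -> Y f y = b y * pder o f y by move=> Wy; exact: (Yb W).
have Pb' : P W b by apply: (reg_sub calcP) Pb.
have Pf' : P W (pder o f) by exact: reg_pder.
rewrite (Xa W (Y f)) // ?(pder_ext _ oW Wx YE) ?(pder_mul calcP _ oW Wx) //.
apply: (reg_ext calcP oW (f := fun y => b y * pder o f y)).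
  by move=> y Wy; rewrite YE.
exact: reg_mul.
Qed.

Lemma squares_fol_bracket V X Y : open V -> squares_fol V X ->
  squares_fol V Y -> squares_fol V (vf_bracket X Y).
Proof.
move=> oV [a [Pa Xa aI]] [b [Pb Yb bI]].
exists (fun x => a x * pder o b x - b x * pder o a x); split.
- by apply: reg_subr => //; apply: reg_mul => //; exact: reg_pder.
- move=> W f oW WV Pf x Wx; rewrite /vf_bracket.
  rewrite (along_comp Xa Yb oV Pb oW) // (along_comp Yb Xa oV Pa oW) //; ring.
- exact: in_ideal_bracket.
Qed.

Definition sq_field (l : 'I_n) : operator M := fun f x => sq l x * pder o f x.

Lemma sq_field_fol V l : open V -> squares_fol V (sq_field l).
Proof.
move=> oV; exists (sq l); split => //; first exact: reg_sq.
move=> x Vx; exists V, (fun k _ => (k == l)%:R); split => //.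
  by move=> k; exact: reg_cst.
move=> y Vy; rewrite (bigD1 l) //= eqxx mul1r big1 ?addr0 //.
by move=> k /negPf ->; rewrite mul0r.
Qed.

Lemma sq_field_generators V : open V -> generators squares_fol V sq_field.
Proof.
move=> oV; split; first by move=> l; exact: sq_field_fol.
move=> W Y oW WV [a [Pa Ya aI]] x Wx.
have [W' [b [oW' W'x W'W Pb ab]]] := aI x Wx.
exists W', b; split => //; first by move=> i; apply/regularE.
move=> W'' f oW'' W''W' /regularE Pf y W''y.
rewrite (Ya W'' f) //; last exact: subset_trans W'W.
rewrite ab /vf_comb; last exact: W''W'.
by rewrite mulr_suml; apply: eq_bigr => l _; rewrite /sq_field mulrA.
Qed.

Definition squares_foliation : singular_foliation M.
refine (@SingularFoliation O M squares_fol _ squares_fol_eq squares_fol_restr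
  squares_fol_glue squares_fol_zero squares_fol_add squares_fol_scale
  squares_fol_bracket _).
- by move=> V X oV [a [Pa Xa _]]; exact: along_vector_field Xa oV.
- move=> m; exists n, setT, sq_field; split => //; first exact: openT.
  by apply: sq_field_generators; exact: openT.
Defined.

(** * Generators near the origin and the rank *)

Lemma open_forall (I : finType) U (x : M) (Q : I -> set M -> Prop) :
  open U -> U x ->
  (forall i, exists W, [/\ open W, W x, W `<=` U & Q i W]) ->
  (forall i V W, open V -> open W -> W `<=` V -> Q i V -> Q i W) ->
  exists W, [/\ open W, W x, W `<=` U & forall i, Q i W].
Proof.
move=> oU Ux ex sub.
have /choice[V HV] : forall i, exists W, [/\ open W, W x, W `<=` U & Q i W] by [].
pose W := [set y | forall i, V i y].
exists (U `&` W°); split.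
- by apply: openI => //; exact: open_interior.
- split=> //; apply: (@filter_forall _ I (fun i => V i) (nbhs x)) => i.
  by have [? ? _ _] := HV i; exact: open_nbhs_nbhs.
- by move=> y [].
- move=> i; have [oV _ _ QV] := HV i.
  apply: (sub i (V i)) => //; first by apply: openI => //; exact: open_interior.
  by move=> y [_ /interior_subset]; apply.
Qed.

(** The [X i] are combinations of the [sq_field l] with matrix [h], and conversely each [sq_field l]
    is a combination of the [X i]. Composing the two gives the identity up to syzygies of the
    squares, which vanish at 0. The left inverse [h'] of [h] at 0 serves both the lower bound on the
    rank and the invertibility of [H] for a frame. *)
Lemma generators_matrix U k (X : 'I_k -> operator M) : open U -> U 0 ->
  generators squares_fol U X ->
  exists W (h : 'I_k -> 'I_n -> M -> K) (h' : 'I_n -> 'I_k -> K),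
    [/\ open W /\ W 0, W `<=` U, forall i l, P W (h i l),
        forall i, along o W (fun x => \sum_l h i l x * sq l x) (X i) &
        forall l l', \sum_i h' l i * h i l' 0 = (l == l')%:R].
Proof.
move=> oU U0 [XF gen].
pose Q i W := exists b : 'I_n -> M -> K, (forall l, P W (b l)) /\
  along o W (fun x => \sum_l b l x * sq l x) (X i).
have [i|i V W oV oW WV [b [Pb Xb]]|W [oW W0 WU QW]] := @open_forall _ U 0 Q oU U0.
- have [a [Pa Xa aI]] := XF i; have [W [b [oW W0 WU Pb ab]]] := aI 0 U0.
  exists W; split => //; exists b; split => // W' f oW' W'W Pf x W'x.
  rewrite (Xa W' f) // ?ab //; first exact: W'W.
  exact: subset_trans WU.
- exists b; split; first by move=> l; apply: (reg_sub calcP) (Pb l).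
  by move=> W' f oW' W'W Pf x W'x; apply: (Xb W') => //; exact: subset_trans WV.
have /choice[h Hh] := QW.
have gen_sq l : exists v : 'I_k -> K,
    forall l', \sum_i v i * h i l' 0 = (l == l')%:R.
  have [W' [v [oW' W'0 W'W Pv eqv]]] := gen W (sq_field l) oW WU (sq_field_fol l oW) 0 W0.
  exists (fun i => v i 0) => l'.
  have Pvh m i : P W' (fun y => v i y * h i m y).
    apply: reg_mul => //; first exact/regularE.
    by apply: (reg_sub calcP) ((Hh i).1 m).
  have Psum m : P W' (fun y => \sum_i v i y * h i m y) by apply: reg_sum.
  (* The syzygy: composed coefficients of [sq_field l] minus the trivial ones. The relation is
     obtained by evaluating the fields on the coordinate x_o. *)
  pose a m (y : M) : K := (\sum_i v i y * h i m y) - (l == m)%:R.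
  have Pa m : P W' (a m) by apply: reg_subr => //; exact: reg_cst.
  have [|+ _] := sq_syzygy calcP oW' W'0 Pa _ l'.
    move=> y W'y; rewrite /a; under eq_bigr do rewrite mulrBl.
    rewrite sumrB [X in _ - X](bigD1 l) //= eqxx mul1r [X in _ - (_ + X)]big1 ?addr0; last first.
      by move=> m /negPf ml; rewrite eq_sym ml mul0r.
    have Pco : P W' (fun y => y 0 o) by exact: reg_coord.
    have := eqv W' _ oW' (@subset_refl _ _) ((regularE _ _).2 Pco) y W'y.
    rewrite /sq_field pder_coord eqxx mulr1 => ->; apply/eqP; rewrite subr_eq0.
    under eq_bigr do rewrite mulr_suml.
    rewrite exchange_big /=; apply/eqP; apply: eq_bigr => i _.
    rewrite (along_coord (Hh i).2) //; last exact: W'W.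
    by rewrite mulr_sumr; apply: eq_bigr => m _; rewrite mulrA.
  by rewrite /a => /eqP; rewrite subr_eq0 => /eqP.
have /choice[h' Hh'] := gen_sq.
by exists W, h, h'; split => // i; have [] := Hh i.
Qed.

Lemma squares_rank : is_rank squares_foliation (0 : 'rV[K]_n) n.
Proof.
split.
  exists setT, sq_field; split => //; first exact: openT.
  by apply: sq_field_generators; exact: openT.
move=> k [U [X [oU U0 gen]]].
have [W [h [h' [_ _ _ _ h'h]]]] := generators_matrix oU U0 gen.
(* The identity of size [n] factors through dimension [k], so n <= k. *)
apply: (@mulmx1_min K _ _ (\matrix_(l, i) h' l i) (\matrix_(i, l) h i l 0)).
apply/matrixP => l l'; rewrite !mxE -h'h.
by apply: eq_bigr => i _; rewrite !mxE.
Qed.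

(** * Sections and brackets of a Lie algebroid *)

Section Algebroid.
Variables (U : set M) (r : nat) (A : lie_algebroid U r).
Implicit Types s u v : forall x, fiber A x.

Lemma is_section_sub V W s : open V -> open W -> W `<=` V ->
  is_section V s -> is_section W s.
Proof.
move=> oV oW WV sV t tA j; apply/regularE.
have oT := triv_open tA.
apply: (reg_sub calcP) ((regularE _ _).1 (sV t tA j)); try exact: openI.
by move=> x [Wx tx]; split => //; exact: WV.
Qed.

Lemma is_section0 V : open V -> is_section V (fun x => 0 : fiber A x).
Proof.
move=> oV t tA j; apply/regularE.
have oVT := openI oV (triv_open tA).
apply: (reg_ext calcP oVT (f := fun=> 0)); last exact: reg_cst.
by move=> x _; rewrite linear0 mxE.
Qed.

Lemma is_section_add V s u : open V -> is_section V s -> is_section V u ->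
  is_section V (fun x => s x + u x).
Proof.
move=> oV sV uV t tA j; apply/regularE.
have oVT := openI oV (triv_open tA).
have /regularE Ps := sV t tA j; have /regularE Pu := uV t tA j.
apply: (reg_ext calcP oVT _ (reg_add calcP oVT Ps Pu)).
by move=> x _ /=; rewrite linearD mxE.
Qed.

Lemma is_section_scale V f s : open V -> P V f -> is_section V s ->
  is_section V (fun x => f x *: s x).
Proof.
move=> oV Pf sV t tA j; apply/regularE.
have oVT := openI oV (triv_open tA).
have /regularE Ps := sV t tA j.
have Pf' : P (V `&` triv_dom t) f by apply: (reg_sub calcP) Pf => // x [].
apply: (reg_ext calcP oVT _ (reg_mul calcP oVT Pf' Ps)).
by move=> x _ /=; rewrite linearZ mxE.
Qed.

Lemma is_section_sum V (I : Type) (q : seq I) (f : I -> M -> K)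
    (s : I -> forall x, fiber A x) : open V ->
  (forall i, P V (f i)) -> (forall i, is_section V (s i)) ->
  is_section V (fun x => \sum_(i <- q) f i x *: s i x).
Proof.
move=> oV Pf sV; elim: q => [|i q IH].
  rewrite (_ : (fun x => _) = fun x => 0); first exact: is_section0.
  by apply: functional_extensionality_dep => x; rewrite big_nil.
rewrite (_ : (fun x => _) = fun x => f i x *: s i x + \sum_(j <- q) f j x *: s j x).
  by apply: is_section_add => //; exact: is_section_scale.
by apply: functional_extensionality_dep => x; rewrite big_cons.
Qed.

Variable V : set M.
Hypotheses (oV : open V) (VU : V `<=` U).

Lemma is_section_bracket s u : is_section V s -> is_section V u ->
  is_section V (bracket s u).
Proof. by move=> sV uV t; apply: bracket_section. Qed.

Lemma bracketNC s u x : is_section V s -> is_section V u -> V x ->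
  bracket s u x = - bracket u s x.
Proof. by move=> sV uV Vx; exact: (bracket_anticomm oV VU). Qed.

Lemma bracketDr s u v x : is_section V s -> is_section V u ->
  is_section V v -> V x ->
  bracket s (fun y => u y + v y) x = bracket s u x + bracket s v x.
Proof.
move=> sV uV vV Vx; rewrite !(bracketNC sV) //; last exact: is_section_add.
rewrite (_ : (fun y => u y + v y) = fun y => 1 *: u y + v y); last first.
  by apply: functional_extensionality_dep => y; rewrite scale1r.
by rewrite (bracket_linear 1 oV VU) // scale1r opprD.
Qed.

Lemma bracket0r s x : is_section V s -> V x ->
  bracket s (fun y => 0) x = 0.
Proof.
move=> sV Vx; have s0 := is_section0 oV.
apply: (addrI (bracket s (fun y => 0) x)); rewrite -bracketDr // addr0.
congr (bracket s _ x).
by apply: functional_extensionality_dep => y; rewrite addr0.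
Qed.

Lemma bracket_sumr (I : Type) (q : seq I) (f : I -> M -> K)
    (u : I -> forall x, fiber A x) s x : is_section V s -> V x ->
  (forall i, P V (f i)) -> (forall i, is_section V (u i)) ->
  bracket s (fun y => \sum_(i <- q) f i y *: u i y) x =
  \sum_(i <- q) (f i x *: bracket s (u i) x + anchor (s x) (f i) *: u i x).
Proof.
move=> sV Vx Pf uV; elim: q => [|i q IH].
  rewrite big_nil -[RHS](bracket0r sV Vx); congr (bracket s _ x).
  by apply: functional_extensionality_dep => y; rewrite big_nil.
rewrite (_ : (fun x => _) = fun x => f i x *: u i x + \sum_(j <- q) f j x *: u j x).
  rewrite bracketDr ?IH ?big_cons //; last 2 first.
  - exact: is_section_scale.
  - exact: is_section_sum.
  by rewrite (bracket_leibniz oV VU) //; exact/regularE.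
by apply: functional_extensionality_dep => y; rewrite big_cons.
Qed.

(** The Jacobi identity in derivation form: bracketing with [s] is a derivation of the bracket. *)
Lemma bracket_adjoint s u v x : is_section V s -> is_section V u ->
  is_section V v -> V x ->
  bracket s (bracket u v) x = bracket u (bracket s v) x + bracket (bracket s u) v x.
Proof.
move=> sV uV vV Vx.
have buv : is_section V (bracket u v) by exact: is_section_bracket.
have bsu : is_section V (bracket s u) by exact: is_section_bracket.
have bsv : is_section V (bracket s v) by exact: is_section_bracket.
have bvs : is_section V (bracket v s) by exact: is_section_bracket.
(* Anticommutativity holds pointwise on [V] only, so it is used inside the outer bracket through
   [bracket_local]. *)
have : bracket u (fun y => bracket v s y + bracket s v y) x = 0.
  rewrite -[RHS](bracket0r uV Vx).
  apply: (bracket_local oV VU) => //; first exact: is_section_add.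
  by move=> y Vy; rewrite (bracketNC vV sV Vy) addNr.
rewrite bracketDr // => /eqP; rewrite addr_eq0 => /eqP e.
have := bracket_jacobi oV VU sV uV vV Vx.
rewrite e (bracketNC vV bsu Vx) => /eqP; rewrite subr_eq0 => /eqP <-.
by rewrite addrC subrK.
Qed.

(* Both sides of [s,[u,f v]] = [u,[s,f v]] + [[s,u],f v] are expanded with the
   Leibniz identity. *)
Lemma anchor_bracket f s u v x : is_section V s -> is_section V u ->
  is_section V v -> P V f ->
  P V (fun y => anchor (s y) f) -> P V (fun y => anchor (u y) f) -> V x ->
  (anchor (s x) (fun y => anchor (u y) f) - anchor (u x) (fun y => anchor (s y) f)
    - anchor (bracket s u x) f) *: v x = 0.
Proof.
move=> sV uV vV Pf Psf Puf Vx.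
have sec := is_section_bracket.
have fvV : is_section V (fun y => f y *: v y) by exact: is_section_scale.
have leib w y : is_section V w -> V y -> bracket w (fun y => f y *: v y) y =
    f y *: bracket w v y + anchor (w y) f *: v y.
  by move=> wV Vy; rewrite (bracket_leibniz oV VU) //; exact/regularE.
have expand w1 w2 : is_section V w1 -> is_section V w2 ->
    P V (fun y => anchor (w2 y) f) ->
    bracket w1 (bracket w2 (fun y => f y *: v y)) x =
    f x *: bracket w1 (bracket w2 v) x + anchor (w1 x) f *: bracket w2 v x
    + (anchor (w2 x) f *: bracket w1 v x
       + anchor (w1 x) (fun y => anchor (w2 y) f) *: v x).
  move=> w1V w2V Pw2.
  rewrite (bracket_local oV VU w1V (sec _ _ w2V fvV) (s' := w1)
    (t' := fun y => f y *: bracket w2 v y + anchor (w2 y) f *: v y)) //; last first.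
    by move=> y Vy; rewrite leib.
  have w2v := sec _ _ w2V vV.
  have bscale g w : P V g -> is_section V w -> bracket w1 (fun y => g y *: w y) x =
      g x *: bracket w1 w x + anchor (w1 x) g *: w x.
    by move=> Pg wV; rewrite (bracket_leibniz oV VU) //; exact/regularE.
  by rewrite bracketDr ?bscale //; exact: is_section_scale.
have := bracket_adjoint sV uV fvV Vx.
rewrite !expand // (leib (bracket s u)) //; last exact: sec.
rewrite bracket_adjoint // scalerDr.
set a := f x *: bracket u _ x; set b := f x *: bracket (bracket s u) v x.
set p := anchor (s x) f *: _; set q := anchor (u x) f *: _.
(* The terms [a], [b], [p], [q] occur on both sides; cancelling them leaves S = T + N, the claim. *)
move=> e; rewrite !scalerBl.
set S := _ *: v x; set T := _ *: v x; set N := _ *: v x.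
have : a + b + p + q + S = a + b + p + q + (T + N).
  by rewrite -(addrA (a + b + p)) e (AC (2*2*2) (1*5*3*2*(4*6))).
by move/addrI => ->; rewrite addrAC addrK subrr.
Qed.

End Algebroid.

(** * Local frames and their coefficients *)

Section Frame.
Variables (U : set M) (r : nat) (A : lie_algebroid U r).
Variable t : trivialization (fiber A) r.
Hypothesis tA : triv_atlas t.

Definition frame (i : 'I_r) : forall x, fiber A x :=
  fun x => triv_inv t x (basis_vector K i).

Definition coef (s : forall x, fiber A x) (i : 'I_r) (x : M) : K :=
  triv_map t x (s x) 0 i.

Lemma frame_section i : is_section (triv_dom t) (frame i).
Proof. by move=> t' t'A j; apply: triv_transition. Qed.

Lemma coef_frame i j x : triv_dom t x -> coef (frame i) j x = (i == j)%:R.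
Proof. by move=> tx; rewrite /coef triv_invK // mxE eqxx eq_sym. Qed.

Lemma frame_expand s x : triv_dom t x -> s x = \sum_i coef s i x *: frame i x.
Proof.
move=> tx; apply: (can_inj (triv_mapK tA tx)).
rewrite linear_sum [LHS]row_sum_delta; apply: eq_bigr => i _.
by rewrite linearZ /= triv_invK.
Qed.

Lemma coef_regular V s i : open V -> V `<=` triv_dom t -> is_section V s ->
  P V (coef s i).
Proof.
move=> oV Vt sV; have /regularE := sV t tA i.
by rewrite (_ : V `&` triv_dom t = V) //; apply/setIidPl.
Qed.

Lemma anchor_sum (I : Type) (q : seq I) (a : I -> K) x (v : I -> fiber A x) W f :
  U x -> open W -> W x -> P W f ->
  anchor (\sum_(i <- q) a i *: v i) f = \sum_(i <- q) a i * anchor (v i) f.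
Proof.
move=> Ux oW Wx /regularE Pf; elim: q => [|i q IH].
  rewrite !big_nil; have := anchor_linear 1 (0 : fiber A x) 0 Ux oW Wx Pf.
  by rewrite scaler0 addr0 mul1r => /eqP; rewrite -subr_eq0 opprD addNKr oppr_eq0 => /eqP.
by rewrite !big_cons (anchor_linear _ _ _ Ux oW Wx Pf) IH.
Qed.

(** A field of the foliation lifts locally to a section, whose coefficients in the frame are
    regular; linearity of the anchor carries the expansion to the fields. *)
Lemma frame_generators : induces A squares_foliation ->
  generators squares_fol (triv_dom t) (fun i => anchor_field (frame i)).
Proof.
move=> ind; have oT := triv_open tA; have TU := triv_sub tA.
split.
  move=> i; apply/(ind (triv_dom t) _ oT TU); split.
    exact: anchor_regular (frame_section i).
  move=> x Tx; exists (triv_dom t), (frame i); split => //; exact: frame_section.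
move=> V Y oV VT /(ind V Y oV (subset_trans VT TU))[_ loc] x Vx.
have [W [s [oW Wx WV sW Ys]]] := loc x Vx.
exists W, (coef s); split => //.
  move=> i; apply/regularE; apply: coef_regular => //; exact: subset_trans VT.
move=> W' f oW' W'W Pf y W'y; rewrite (Ys W' f) // /anchor_field /vf_comb.
have Ty : triv_dom t y by apply: VT; apply: WV; exact: W'W.
rewrite (frame_expand s Ty) (anchor_sum _ _ _ (TU _ Ty) oW' W'y) //.
exact/regularE.
Qed.

End Frame.

(** A frame near 0 gives [n] generators, so the matrix [h] of [generators_matrix] is square, and the
    structure functions of the frame satisfy the hypotheses of [no_jacobi]. *)
Lemma squares_not_induced (z : 'I_n) U (A : lie_algebroid U n) :
  (2 < n)%N -> o != z -> U 0 -> ~ induces A squares_foliation.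
Proof.
move=> n2 oz U0 ind.
have [t tA T0] := triv_cover A U0.
have oT := triv_open tA; have TU := triv_sub tA.
have [W [h [h' [[oW W0] WT Ph along_h h'h]]]] :=
  generators_matrix oT T0 (frame_generators tA ind).
have WU := subset_trans WT TU.
pose e := frame (A := A) t.
have eW i : is_section W (e i) by apply: is_section_sub (frame_section tA i).
have beW i j : is_section W (bracket (e i) (e j)) by exact: is_section_bracket.
pose g i (x : M) := \sum_l h i l x * sq l x.
pose co (y : M) : K := y 0 o.
have Pco V : open V -> P V co by exact: reg_coord.
have anchor_co i x : W x -> anchor (e i x) co = g i x.
  by move=> Wx; rewrite -[RHS](along_coord (along_h i)).
have Pg i : P W (g i).
  apply: reg_sum => // l; apply: reg_mul => //; exact: reg_sq.
pose c i j k := coef t (bracket (e i) (e j)) k.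
have Pc i j k : P W (c i j k) by apply: coef_regular.
apply: (@no_jacobi K n P calcP W o z h c h') => //.
- move=> i j x Wx.
  have Panchor k : P W (fun y => anchor (e k y) co).
    by apply: (reg_ext calcP oW _ (Pg k)) => y Wy; rewrite anchor_co.
  (* The conclusion is a scalar times the test section. Taking [e o] as test section and reading its
     [o]-th coefficient, which is 1, isolates the scalar. *)
  have := anchor_bracket oW WU (eW i) (eW j) (eW o) (Pco _ oW) (Panchor i) (Panchor j) Wx.
  have anchor2 k l : anchor (e k x) (fun y => anchor (e l y) co) =
      g k x * pder o (g l) x.
    rewrite -[LHS]/(anchor_field (e k) (fun y => anchor (e l y) co) x).
    rewrite (along_h k W) //; congr (_ * _); apply: (pder_ext o oW Wx) => y.
    exact: anchor_co.
  rewrite !anchor2 (frame_expand tA (bracket (e i) (e j)) (WT _ Wx)).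
  rewrite (anchor_sum _ _ _ (WU _ Wx) oW Wx (Pco _ oW)).
  move/(congr1 (fun v => triv_map t x v 0 o)).
  rewrite linearZ linear0 mxE [X in _ * X](coef_frame tA) ?eqxx; last exact: WT.
  rewrite mulr1 mxE => /eqP; rewrite subr_eq0 => /eqP ->.
  by apply: eq_bigr => k _; rewrite anchor_co.
- move=> i j k m x Wx.
  (* Expand the inner bracket in the frame and apply the Leibniz identity: the anchor differentiates
     the structure functions, and only l = m contributes to the component [m]. *)
  have jacE i' j' k' : \sum_l c i' j' l x * c k' l m x
      + (\sum_l h k' l x * sq l x) * pder o (c i' j' m) x
      = coef t (bracket (e k') (bracket (e i') (e j'))) m x.
    rewrite /coef (bracket_local oW WU (eW k') (beW i' j') (s' := e k')
      (t' := fun y => \sum_l c i' j' l y *: e l y)) //; last first.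
      by move=> y Wy; exact: (frame_expand tA _ (WT _ Wy)).
    rewrite (bracket_sumr oW WU) // linear_sum summxE.
    transitivity (\sum_l (c i' j' l x * c k' l m x
        + anchor (e k' x) (c i' j' l) * (l == m)%:R)).
      rewrite big_split /=; congr (_ + _).
      rewrite [RHS](bigD1 m) //= eqxx mulr1 [X in _ + X]big1 ?addr0; last first.
        by move=> l /negPf ->; rewrite mulr0.
      by rewrite -[RHS]/(anchor_field (e k') (c i' j' m) x) (along_h k' W).
    apply: eq_bigr => l _; rewrite linearD !linearZ !mxE; congr (_ + _ * _).
    by rewrite -[RHS]/(coef t (e l) m x) coef_frame //; exact: WT.
  rewrite !jacE /coef.
  have := bracket_jacobi oW WU (eW k) (eW i) (eW j) Wx.
  move/(congr1 (fun v => triv_map t x v 0 m)).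
  by rewrite !linearD linear0 !mxE.
Qed.

End Affine.

Theorem not_induced_by_minimal_rank (O : function_theory) :
  calculus (@model_regular O 3) -> @second_countable 'rV[scalars O]_3 ->
  exists (M : manifold O) (F : singular_foliation M) (m : M) (r : nat),
    is_rank F m r /\
    forall U : set M, open U -> U m ->
      ~ exists A : lie_algebroid U r, induces A F.
Proof.
move=> calcP scK; exists (affine_space calcP scK), (squares_foliation calcP scK ord0).
exists (0 : 'rV[scalars O]_3), 3%N; split; first exact: squares_rank.
(* The field is d/dx_0 and the second derivative is taken along x_2. *)
by move=> U _ U0 [A]; exact: (squares_not_induced (z := ord_max)).
Qed.

(** * Smooth functions *)

Section Smooth.
Variables (K : numFieldType) (n : nat).
Implicit Types (U : set 'rV[K]_n) (f g : 'rV[K]_n -> K^o).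

Lemma of_classW k U f : of_class k.+1 U f -> of_class k U f.
Proof.
elim: k f => [|k IH] f [fc fD]; first by split.
by split => // i; have [? /IH] := fD i.
Qed.

Lemma of_class_ext k U f g : open U -> (forall x, U x -> f x = g x) ->
  of_class k U f -> of_class k U g.
Proof.
move=> oU; elim: k f g => [|k IH] f g fg [fc fD].
all: have nfg x : U x -> \near x, f x = g x
  by move=> Ux; near=> y; apply: fg; near: y; exact: open_nbhs_nbhs.
all: have gc x : U x -> {for x, continuous g}
  by move=> Ux; rewrite /prop_for /continuous_at -(fg x Ux);
     exact: cvg_trans (near_eq_cvg (nfg x Ux)) (fc x Ux).
  by split.
split=> // i; have [fd fDi] := fD i; split.
  move=> x Ux; apply: near_eq_derivable (fd x Ux); exact: nfg.
by apply: IH fDi => x Ux; exact: near_eq_derive (nfg x Ux).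
Unshelve. all: end_near. Qed.

Lemma of_class_add k U f g : open U -> of_class k U f -> of_class k U g ->
  of_class k U (fun x => f x + g x).
Proof.
move=> oU; elim: k f g => [|k IH] f g [fc fD] [gc gD].
  by split=> // x Ux; apply: continuousD; [exact: fc|exact: gc].
split; first by move=> x Ux; apply: continuousD; [exact: fc|exact: gc].
move=> i; have [fd fDi] := fD i; have [gd gDi] := gD i; split.
  by move=> x Ux; apply: derivableD; [exact: fd|exact: gd].
apply: of_class_ext (IH _ _ fDi gDi) => // x Ux.
by rewrite -deriveD //; [exact: fd|exact: gd].
Qed.

(** In the Leibniz rule an undifferentiated factor meets a derivative of one class less, so its
    class is lowered by [of_classW] before the induction hypothesis applies. *)
Lemma of_class_mul k U f g : open U -> of_class k U f -> of_class k U g ->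
  of_class k U (fun x => f x * g x).
Proof.
move=> oU; elim: k f g => [|k IH] f g fk gk; have [fc fD] := fk; have [gc gD] := gk.
  by split=> // x Ux; apply: (@continuousM K); [exact: fc|exact: gc].
split; first by move=> x Ux; apply: (@continuousM K); [exact: fc|exact: gc].
move=> i; have [fd fDi] := fD i; have [gd gDi] := gD i; split.
  by move=> x Ux; apply: (@derivableM K); [exact: fd|exact: gd].
have fgD := IH _ _ (of_classW fk) gDi; have gfD := IH _ _ (of_classW gk) fDi.
apply: of_class_ext (of_class_add oU fgD gfD) => // x Ux.
by rewrite -(@deriveM K) //; [exact: fd|exact: gd].
Qed.

Lemma of_class_cst k U (a : K) : of_class k U (fun=> a).
Proof.
elim: k a => [|k IH] a; (split=> [x _|//]);
  try exact: cst_continuous.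
move=> i; split=> [x _|]; first by have [] := is_derive_cst (a : K^o) x (basis_vector K i).
by under eq_fun do rewrite derive_cst; exact: IH.
Qed.

Lemma smooth_calculus : calculus (@smooth K n).
Proof.
split.
- by move=> U f g oU fg fs k; exact: of_class_ext (fs k).
- move=> U V f oU oV VU fs k; have {fs} := fs k.
  elim: k f => [|k IH] f [fc fD]; first by split=> // x /VU; exact: fc.
  split=> [x /VU|i]; first exact: fc.
  by have [fd /IH] := fD i; split=> // x /VU; exact: fd.
- by move=> U a oU k; exact: of_class_cst.
- move=> U i oU [|k]; (split=> [x _|//]); first exact: coord_continuous.
    exact: coord_continuous.
  move=> j; split=> [x _|]; first by have [] := is_derive_coord j i x.
  rewrite (_ : (fun x => _) = fun=> (j == i)%:R); first exact: of_class_cst.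
  by apply/funext => x; have [_] := is_derive_coord j i x.
- by move=> U f g oU fs gs k; exact: of_class_add.
- by move=> U f g oU fs gs k; exact: of_class_mul.
- by move=> U f i x oU fs Ux; have [_ /(_ i)[+ _]] := fs 1%N; exact.
- by move=> U f i oU fs k; have [_ /(_ i)[]] := fs k.+1.
Qed.

End Smooth.

(** * Analytic functions *)

Section PowerSeries.
Variables (K : numFieldType) (n : nat).
Implicit Types (a b : 'I_n -> nat) (u v : 'I_n -> K) (c d : ('I_n -> nat) -> K).

Local Notation hf := (2^-1 : K).
Local Notation qt := (4^-1 : K).
Local Notation box N := {ffun 'I_n -> 'I_N}.

(** * Sums over boxes of exponents *)

Definition mdeg a : nat := \sum_i a i.

Definition bsum N (F : ('I_n -> nat) -> K) : K :=
  \sum_(a : box N) F (fun i => a i).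

Definition mono a u : K := \prod_i u i ^+ a i.

Let hf_ge0 : 0 <= hf. Proof. by rewrite invr_ge0 ler0n. Qed.
Let qt_ge0 : 0 <= qt. Proof. by rewrite invr_ge0 ler0n. Qed.
Let hf_le1 : hf <= 1. Proof. by rewrite invf_le1 ?ltr0n // ler1n. Qed.
Let qtE : qt = hf * hf.
Proof. by rewrite -invfM -natrM. Qed.

(** Split 4^-w as 2^-w 2^-w: one factor is at most 2^-L on [Q], the other is summed. *)
Lemma norm_tail_sum (I : finType) (w : I -> nat) (T : I -> K) (Q : pred I) L
    (B S : K) : 0 <= B ->
  (forall i, `|T i| <= B * qt ^+ w i) -> (forall i, Q i -> (L <= w i)%N) ->
  \sum_i hf ^+ w i <= S -> `|\sum_(i | Q i) T i| <= B * S * hf ^+ L.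
Proof.
move=> B0 TB QL wS; apply: le_trans (ler_norm_sum _ _ _) _.
apply: (@le_trans _ _ (\sum_(i | Q i) B * hf ^+ L * hf ^+ w i)).
  apply: ler_sum => i Qi; apply: le_trans (TB i) _.
  rewrite -mulrA ler_wpM2l // qtE exprMn ler_wpM2r ?exprn_ge0 //.
  by rewrite ler_wiXn2l // QL.
rewrite mulrAC -mulr_sumr ler_wpM2l ?mulr_ge0 ?exprn_ge0 //.
apply: le_trans wS; rewrite [leRHS](bigID Q) /= lerDl.
by apply: sumr_ge0 => i _; rewrite exprn_ge0.
Qed.

Lemma geometric_sum_le N : \sum_(m < N) hf ^+ m <= 2.
Proof.
have -> : \sum_(m < N) hf ^+ m = 2 - 2 * hf ^+ N.
  elim: N => [|N IH]; first by rewrite big_ord0 expr0 mulr1 subrr.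
  by rewrite big_ord_recr /= IH exprS mulrA mulfV ?pnatr_eq0 //; ring.
by rewrite gerBl mulr_ge0 ?exprn_ge0 ?ler0n.
Qed.

(** Over a box the sum factors into [n] geometric sums. *)
Lemma box_weight N : \sum_(a : box N) hf ^+ mdeg (fun i => a i) <= 2 ^+ n.
Proof.
under eq_bigr do rewrite /mdeg expr_sum.
rewrite -(bigA_distr_bigA (fun (i : 'I_n) (m : 'I_N) => hf ^+ m)) /=.
apply: (@le_trans _ _ (\prod_(i < n) 2)); last by rewrite prodr_const card_ord.
apply: ler_prod => i _; rewrite geometric_sum_le andbT.
by apply: sumr_ge0 => m _; rewrite exprn_ge0.
Qed.

Lemma box_pair_weight N :
  \sum_(p : box N * box N) hf ^+ (mdeg (fun i => p.1 i) + mdeg (fun i => p.2 i))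
    <= 2 ^+ n * 2 ^+ n.
Proof.
under eq_bigr do rewrite exprD.
rewrite -(pair_big predT predT (fun a b : box N =>
  hf ^+ mdeg (fun i => a i) * hf ^+ mdeg (fun i => b i))) /=.
rewrite -big_distrlr /= ler_pM ?box_weight //.
all: by apply: sumr_ge0 => m _; rewrite exprn_ge0.
Qed.

Lemma bsum_widen N L F : (N <= L)%N ->
  bsum N.+1 F = \sum_(a : box L.+1 | [forall i, a i < N.+1]%N) F (fun i => a i).
Proof.
move=> NL.
pose h (a : box N.+1) : box L.+1 := [ffun i => inord (a i)].
pose h' (a : box L.+1) : box N.+1 := [ffun i => inord (a i)].
have hE (a : box N.+1) i : h a i = a i :> nat.
  by rewrite ffunE inordK // (leq_trans (ltn_ord _)).
rewrite (reindex_onto h h') /=.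
  apply: eq_big => a.
    symmetry; apply/andP; split; first by apply/forallP => i; rewrite hE.
    apply/eqP/ffunP => i; apply: val_inj; rewrite /= ffunE hE inordK //.
  by move=> _; congr F; apply/funext => i; rewrite hE.
move=> a /forallP aN; apply/ffunP => i; apply: val_inj.
by rewrite /= hE ffunE inordK.
Qed.

Lemma sum_shift N (s : 'I_n -> nat) F :
  \sum_(a : box N.+1 | [forall i, s i <= a i]%N) F (fun i => a i : nat) =
  \sum_(b : box N.+1 | [forall i, s i + b i < N.+1]%N) F (fun i => (s i + b i)%N) :> K.
Proof.
pose h (a : box N.+1) : box N.+1 := [ffun i => inord (s i + a i)].
pose h' (a : box N.+1) : box N.+1 := [ffun i => inord (a i - s i)].
have hE (b : box N.+1) i : (s i + b i < N.+1)%N -> h b i = (s i + b i)%N :> nat.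
  by move=> lt; rewrite ffunE inordK.
rewrite (reindex_onto h h') /=.
  apply: eq_big => b.
    apply/andP/forallP => [[/forallP sh /eqP/ffunP hh] i|lt].
      rewrite ltnNge; apply/negP => ge.
      (* Out of range, [inord] defaults to 0. This would force s_i = 0, and then b_i itself would be
         out of range. *)
      have h0 : h b i = ord0.
        apply: val_inj; rewrite /= ffunE /inord /insubd insubF //.
        by apply/negbTE; rewrite -leqNgt.
      have := sh i; rewrite h0 leqn0 => /eqP si0.
      have := ltn_ord (b i); rewrite -(add0n (b i)) -si0 ltnNge.
      by rewrite ge.
    split; first by apply/forallP => i; rewrite hE // leq_addr.
    apply/eqP/ffunP => i; apply: val_inj; rewrite /= ffunE hE // addKn.
    by rewrite inord_val.
  move=> /andP[/forallP sh /eqP/ffunP hh]; congr F; apply/funext => i.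
  apply: hE; rewrite ltnNge; apply/negP => ge.
  have h0 : h b i = ord0.
    apply: val_inj; rewrite /= ffunE /inord /insubd insubF //.
    by apply/negbTE; rewrite -leqNgt.
  have := sh i; rewrite h0 leqn0 => /eqP si0.
  have := ltn_ord (b i); rewrite -(add0n (b i)) -si0 ltnNge.
  by rewrite ge.
move=> a /forallP sa; apply/ffunP => i; apply: val_inj.
rewrite /= hE ffunE inordK ?subnKC //.
all: by rewrite ?(leq_ltn_trans (leq_subr _ _)).
Qed.

Lemma mono_norm_le a u (s : K) : (forall i, `|u i| <= s) -> `|mono a u| <= s ^+ mdeg a.
Proof.
move=> us; rewrite /mono normr_prod /mdeg expr_sum.
by apply: ler_prod => i _; rewrite normr_ge0 normrX lerXn2r // nnegrE // (le_trans _ (us i)).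
Qed.

Lemma mono_add a b u : mono (fun i => (a i + b i)%N) u = mono a u * mono b u.
Proof. by rewrite /mono -big_split; apply: eq_bigr => i _; rewrite exprD. Qed.

Lemma mdeg_add a b : mdeg (fun i => (a i + b i)%N) = (mdeg a + mdeg b)%N.
Proof. by rewrite /mdeg -big_split. Qed.

Lemma leq_mdeg a i : (a i <= mdeg a)%N.
Proof. by rewrite /mdeg (bigD1 i) //= leq_addr. Qed.

(** * Geometric growth of coefficients and partial sums *)

Definition growth c (B M : K) := forall a, `|c a| <= B * M ^+ mdeg a.

Definition psum c u N := bsum N.+1 (fun a => c a * mono a u).

Lemma term_le c B M s u a : growth c B M -> 0 <= B -> 0 <= M -> M * s <= qt ->
  (forall i, `|u i| <= s) -> 0 <= s -> `|c a * mono a u| <= B * qt ^+ mdeg a.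
Proof.
move=> cBM B0 M0 Ms us s0; rewrite normrM.
apply: (@le_trans _ _ (B * M ^+ mdeg a * s ^+ mdeg a)).
  by apply: ler_pM => //; exact: mono_norm_le.
by rewrite -mulrA -exprMn ler_wpM2l // lerXn2r // nnegrE mulr_ge0.
Qed.

(** The difference runs over exponents outside the smaller box; one of their entries exceeds [N],
    hence so does the total degree. *)
Lemma psum_cauchy c B M s u N L : growth c B M -> 0 <= B -> 0 <= M ->
  M * s <= qt -> (forall i, `|u i| <= s) -> 0 <= s -> (N <= L)%N ->
  `|psum c u L - psum c u N| <= B * 2 ^+ n * hf ^+ N.
Proof.
move=> cBM B0 M0 Ms us s0 NL; rewrite /psum (bsum_widen _ NL) /bsum.
rewrite (bigID (fun a : box L.+1 => [forall i, a i < N.+1]%N)) /= addrAC subrr add0r.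
apply: (norm_tail_sum (w := fun a : box L.+1 => mdeg (fun i => a i))) => //.
- by move=> a; exact: (term_le _ cBM B0 M0 Ms us s0).
- move=> a /forallPn[ i ]; rewrite -leqNgt => Na.
  exact: leq_trans (ltnW Na) (leq_mdeg _ i).
- exact: box_weight.
Qed.

Lemma psum_norm c B M s u N : growth c B M -> 0 <= B -> 0 <= M ->
  M * s <= qt -> (forall i, `|u i| <= s) -> 0 <= s ->
  `|psum c u N| <= B * 2 ^+ n.
Proof.
move=> cBM B0 M0 Ms us s0; rewrite -[leRHS]mulr1 -(expr0 hf).
apply: (norm_tail_sum (w := fun a : box N.+1 => mdeg (fun i => a i))) => //.
  by move=> a; exact: (term_le _ cBM B0 M0 Ms us s0).
exact: box_weight.
Qed.

(* The explicit rate of convergence turns limits of partial sums into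
   inequalities; completeness is needed for derivatives only. *)
Record expands (f : 'rV[K]_n -> K) (x0 : 'rV[K]_n) c (s B M C : K) : Prop := Expands {
  expands_s : 0 < s;
  expands_B : 0 <= B;
  expands_M : 0 <= M;
  expands_Ms : M * s <= qt;
  expands_growth : growth c B M;
  expands_rate : forall x : 'rV[K]_n, (forall i, `|x 0 i - x0 0 i| <= s) -> forall N,
    `|f x - psum c (fun i => x 0 i - x0 0 i) N| <= C * hf ^+ N }.

(** * Expansions with a rate, compared with analyticity *)

Definition has_expansion f x0 := exists c s B M C, expands f x0 c s B M C.

Lemma expands_C f x0 c s B M C : expands f x0 c s B M C -> 0 <= C.
Proof.
case=> s0 _ _ _ _ rate; rewrite -(mulr1 C) -(expr0 hf).
apply: le_trans (rate x0 _ 0%N) => // i.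
by rewrite subrr normr0 ltW.
Qed.

Lemma expands_shrink f x0 c s B M C s' : expands f x0 c s B M C ->
  0 < s' -> s' <= s -> expands f x0 c s' B M C.
Proof.
case=> s0 B0 M0 Ms cBM rate s'0 s's; split => //.
  by apply: le_trans Ms; rewrite ler_wpM2l.
by move=> x xs N; apply: rate => i; exact: le_trans (xs i) s's.
Qed.

(** The order of [K] may be partial, as for complex numbers, but positive elements are real and
    hence comparable. *)
Lemma pos_lower_bound (x y : K) : 0 < x -> 0 < y ->
  exists e, [/\ 0 < e, e <= x & e <= y].
Proof.
move=> x0 y0; have [xy|yx] := real_leP (gtr0_real x0) (gtr0_real y0).
  by exists x.
by exists y; split => //; exact: ltW.
Qed.

Lemma pos_lower_bound_mul (M e y : K) : 0 <= M -> 0 < e -> 0 < y ->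
  exists s, [/\ 0 < s, s <= y & M * s <= e].
Proof.
move=> M0 e0 y0; have M1 : 0 < M + 1 by rewrite ltr_wpDl.
have [s [s0 se sy]] := pos_lower_bound (divr_gt0 e0 M1) y0.
exists s; split => //; apply: (@le_trans _ _ ((M + 1) * s)).
  by rewrite ler_wpM2r ?lerDl // ltW.
by rewrite mulrC -ler_pdivlMr.
Qed.

Lemma le_of_le_add_eps (x y : K) : x \is Num.real -> y \is Num.real ->
  (forall e, 0 < e -> x <= y + e) -> x <= y.
Proof.
move=> xr yr le; rewrite real_leNgt //; apply/negP => yx.
have e0 : 0 < (x - y) / 2 by rewrite divr_gt0 ?subr_gt0 ?ltr0n.
have := le _ e0; rewrite -lerBlDl => xy.
have : x - y < x - y; last by rewrite ltxx.
apply: le_lt_trans xy _.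
by rewrite ltr_pdivrMr ?ltr0n // mulr_natr mulr2n ltrDl subr_gt0.
Qed.

(** The bound [B] on the absolute sums at radius [r] bounds each single term, so the coefficients
    grow at most like r^-1. Radius r/4 then makes partial sums Cauchy at the rate 2^-N, and the
    limit inherits the rate. *)
Lemma analytic_has_expansion U f x0 : analytic U f -> U x0 -> has_expansion f x0.
Proof.
move=> fa Ux0; have [c [r [B [r0 cB fx]]]] := fa x0 Ux0.
have B0 : 0 <= B.
  apply: le_trans (cB 0%N); apply: sumr_ge0 => a _.
  by rewrite mulr_ge0 // prodr_ge0 // => i _; rewrite exprn_ge0 // ltW.
have cBM : growth c B r^-1.
  move=> a; rewrite exprVn ler_pdivlMr ?exprn_gt0 //.
  (* Side [(mdeg a).+1] makes the box large enough to contain [a]. *)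
  pose a' : box (mdeg a).+1 := [ffun i => inord (a i)].
  have a'E : (fun i => a' i : nat) = a.
    by apply/funext => i; rewrite ffunE inordK // ltnS leq_mdeg.
  apply: le_trans (cB (mdeg a).+1); rewrite (bigD1 a') //= a'E.
  have -> : \prod_i r ^+ a' i = r ^+ mdeg a.
    rewrite /mdeg expr_sum; apply: eq_bigr => i _.
    by rewrite -[in RHS]a'E.
  rewrite lerDl; apply: sumr_ge0 => b _.
  by rewrite mulr_ge0 // prodr_ge0 // => i _; rewrite exprn_ge0 // ltW.
have s0 : 0 < r * qt by rewrite mulr_gt0 // invr_gt0 ltr0n.
have Ms : r^-1 * (r * qt) <= qt by rewrite mulrA mulVf ?gt_eqF // mul1r.
exists c, (r * qt), B, r^-1, (B * 2 ^+ n); split => //; first by rewrite invr_ge0 ltW.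
move=> x xs N.
have bx : ball x0 r x.
  split=> // i j; rewrite ord1 /ball /= distrC; apply: le_lt_trans (xs j) _.
  by rewrite gtr_pMr // invf_lt1 ?ltr0n // ltr1n.
apply: le_of_le_add_eps; rewrite ?normr_real //.
  by rewrite ger0_real // !mulr_ge0 ?exprn_ge0 ?ler0n.
move=> e e0.
have /cvgrPdist_lt/(_ e e0)[N1 _ HN1] := fx x bx.
(* [analytic] uses boxes of side [N], while [psum] at [L] uses side [L.+1]. *)
pose L := maxn N N1.
have L1 : (N1 <= L.+1)%N by rewrite leqW // leq_maxr.
apply: le_trans (ler_distD (psum c (fun i => x 0 i - x0 0 i) L) _ _) _.
rewrite [leLHS]addrC; apply: lerD.
  apply: (psum_cauchy cBM B0 _ Ms xs); rewrite ?invr_ge0 ?(ltW r0) ?(ltW s0) //.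
  exact: leq_maxl.
by apply: ltW; exact: HN1.
Qed.

Hypothesis arch : forall e : K, 0 < e -> exists N, hf ^+ N < e.

Lemma arch_lt (C e : K) : 0 <= C -> 0 < e ->
  exists N, forall L, (N <= L)%N -> C * hf ^+ L < e.
Proof.
move=> C0 e0; have C1 : 0 < C + 1 by rewrite ltr_wpDl.
have [N Ne] := arch (divr_gt0 e0 C1); exists N => L NL.
have hL : hf ^+ L < e / (C + 1).
  by apply: le_lt_trans Ne; rewrite ler_wiXn2l.
apply: (@le_lt_trans _ _ ((C + 1) * hf ^+ L)).
  by rewrite ler_wpM2r ?exprn_ge0 // lerDl.
by rewrite mulrC -ltr_pdivlMr.
Qed.

Lemma le_of_le_rate (x y C : K) : x \is Num.real -> y \is Num.real -> 0 <= C ->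
  (forall N, x <= y + C * hf ^+ N) -> x <= y.
Proof.
move=> xr yr C0 le; apply: le_of_le_add_eps => // e e0.
have [N /(_ N (leqnn _)) Ne] := arch_lt C0 e0.
by apply: le_trans (le N) _; rewrite lerD2l ltW.
Qed.

Lemma has_expansion_analytic U f : (forall x, U x -> has_expansion f x) ->
  analytic U f.
Proof.
move=> fe x0 Ux0; have [c [s [B [M [C E]]]]] := fe x0 Ux0.
have [s0 B0 M0 Ms cBM rate] := E; have C0 := expands_C E.
exists c, s, (B * 2 ^+ n); split => //.
- move=> N.
  have -> : \sum_(a : box N) `|c (fun i => a i)| * \prod_i s ^+ a i =
      \sum_(a : box N | predT a) `|c (fun i => a i)| * s ^+ mdeg (fun i => a i).
    by apply: eq_bigr => a _; rewrite /mdeg expr_sum.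
  rewrite -[leRHS]mulr1 -(expr0 hf).
  apply: le_trans (real_ler_norm _) _.
    by apply: ger0_real; apply: sumr_ge0 => a _; rewrite mulr_ge0 // exprn_ge0 // ltW.
  apply: (norm_tail_sum (w := fun a : box N => mdeg (fun i => a i))) => //.
    move=> a; rewrite normrM normr_id (ger0_norm (exprn_ge0 _ (ltW s0))).
    apply: (@le_trans _ _ (B * M ^+ mdeg (fun i => a i) * s ^+ mdeg (fun i => a i))).
      by rewrite ler_wpM2r // exprn_ge0 // ltW.
    by rewrite -mulrA -exprMn ler_wpM2l // lerXn2r // nnegrE mulr_ge0 // ltW.
  exact: box_weight.
- move=> x [_ xs]; apply/cvgrPdist_lt => e e0.
  have [N HN] := arch_lt C0 e0.
  exists N.+1 => // -[//|L] /= NL.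
  apply: le_lt_trans (HN L NL); apply: rate => i.
  by have := xs 0 i; rewrite /ball /= distrC => /ltW.
Qed.

Lemma has_expansion_ext U f g x0 : open U -> U x0 -> (forall x, U x -> f x = g x) ->
  has_expansion f x0 -> has_expansion g x0.
Proof.
move=> oU Ux0 fg [c [s [B [M [C E]]]]].
have /nbhs_ballP[e /= e0 eU] : nbhs x0 U by exact: open_nbhs_nbhs.
(* Halving [e] puts the closed polydisc of radius [t] inside the open ball. *)
have [t [t0 te ts]] := pos_lower_bound (divr_gt0 e0 (ltr0Sn K 1)) (expands_s E).
have [_ B0 M0 Mt cBM rate] := expands_shrink E t0 ts.
exists c, t, B, M, C; split => // x xt N.
rewrite -fg; first exact: rate.
apply: eU; split=> // i j; rewrite ord1 /ball /= distrC; apply: le_lt_trans (xt j) _.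
apply: le_lt_trans te _.
by rewrite ltr_pdivrMr ?ltr0n // mulr_natr mulr2n ltrDl.
Qed.

Lemma has_expansion_add f g x0 : has_expansion f x0 -> has_expansion g x0 ->
  has_expansion (fun x => f x + g x) x0.
Proof.
move=> [c1 [s1 [B1 [M1 [C1 E1]]]]] [c2 [s2 [B2 [M2 [C2 E2]]]]].
have [s [s0 ss1 ss2]] := pos_lower_bound (expands_s E1) (expands_s E2).
have [s10 B10 M10 _ G1 _] := E1; have [s20 B20 M20 _ G2 _] := E2.
have qt0 : 0 < qt by rewrite invr_gt0 ltr0n.
have [t [t0 ts Mt]] := pos_lower_bound_mul (addr_ge0 M10 M20) qt0 s0.
have [_ _ _ _ _ R1] := expands_shrink E1 t0 (le_trans ts ss1).
have [_ _ _ _ _ R2] := expands_shrink E2 t0 (le_trans ts ss2).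
exists (fun a => c1 a + c2 a), t, (B1 + B2), (M1 + M2), (C1 + C2); split => //.
- exact: addr_ge0.
- exact: addr_ge0.
- move=> a; apply: le_trans (ler_normD _ _) _; rewrite mulrDl; apply: lerD.
    apply: le_trans (G1 a) _; rewrite ler_wpM2l // lerXn2r ?nnegrE ?addr_ge0 //.
    by rewrite lerDl.
  apply: le_trans (G2 a) _; rewrite ler_wpM2l // lerXn2r ?nnegrE ?addr_ge0 //.
  by rewrite lerDr.
- move=> x xt N; have := R1 x xt N; have := R2 x xt N.
  set p1 := psum c1 _ _; set p2 := psum c2 _ _ => r2 r1.
  have -> : psum (fun a => c1 a + c2 a) (fun i => x 0 i - x0 0 i) N = p1 + p2.
    rewrite /p1 /p2 /psum /bsum -big_split; apply: eq_bigr => a _.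
    by rewrite mulrDl.
  rewrite opprD addrACA mulrDl; apply: le_trans (ler_normD _ _) _.
  exact: lerD.
Qed.

(** * Products of power series *)

Lemma bsum_support N L F : (N <= L)%N ->
  (forall a, ~ (forall i, (a i <= N)%N) -> F a = 0) -> bsum N.+1 F = bsum L.+1 F.
Proof.
move=> NL F0; rewrite (bsum_widen _ NL).
rewrite [RHS](bigID (fun a : box L.+1 => [forall i, a i < N.+1]%N)) /=.
rewrite [X in _ = _ + X]big1 ?addr0 // => a aN; apply: F0 => aL.
by move/negP: aN; apply; apply/forallP => i; exact: aL.
Qed.

(** Coefficients of the Cauchy product. The box of side [(mdeg g).+1] contains every exponent below
    [g]. *)
Definition conv c d (g : 'I_n -> nat) : K :=
  bsum (mdeg g).+1 (fun a =>
    if [forall i, a i <= g i]%N then c a * d (fun i => (g i - a i)%N) else 0).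

Lemma convE c d N (g : box N.+1) : conv c d (fun i => g i) =
  \sum_(a : box N.+1 | [forall i, a i <= g i]%N)
    c (fun i => a i) * d (fun i => (g i - a i)%N).
Proof.
rewrite /conv; set F := fun a => if _ then _ else _.
have F0 m a : (forall i, (g i <= m)%N) -> ~ (forall i, (a i <= m)%N) -> F a = 0.
  move=> gm am; rewrite /F ifN //; apply/negP => /forallP ag; apply: am => i.
  exact: leq_trans (ag i) (gm i).
rewrite (@bsum_support _ (maxn N (mdeg (fun i => g i)))) ?leq_maxr //; last first.
  by move=> a; apply: F0 => i; exact: leq_mdeg.
rewrite -(@bsum_support N) ?leq_maxl //.
  by rewrite /bsum [RHS]big_mkcond.
by move=> a; apply: F0 => i; rewrite -ltnS.
Qed.

Lemma mdeg_sub a g : (forall i, a i <= g i)%N ->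
  (mdeg a + mdeg (fun i => (g i - a i)%N) = mdeg g)%N.
Proof.
move=> ag; rewrite -mdeg_add; congr mdeg; apply/funext => i.
by rewrite subnKC.
Qed.

(** Instead of counting the exponents a <= g, insert 1 <= 2^|g| 2^-|a|: the first factor doubles the
    growth rate and the second sums to at most 2^n. *)
Lemma growth_conv c d B1 M1 B2 M2 : growth c B1 M1 -> growth d B2 M2 ->
  0 <= B1 -> 0 <= M1 -> 0 <= B2 -> 0 <= M2 ->
  growth (conv c d) (B1 * B2 * 2 ^+ n) (2 * (M1 + M2)).
Proof.
move=> Gc Gd B10 M10 B20 M20 g.
have M0 : 0 <= M1 + M2 by exact: addr_ge0.
rewrite /conv /bsum; apply: le_trans (ler_norm_sum _ _ _) _.
apply: (@le_trans _ _ (\sum_(a : box (mdeg g).+1)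
    B1 * B2 * (2 * (M1 + M2)) ^+ mdeg g * hf ^+ mdeg (fun i => a i))).
  apply: ler_sum => a _.
  have rhs0 : 0 <= B1 * B2 * (2 * (M1 + M2)) ^+ mdeg g * hf ^+ mdeg (fun i => a i).
    by rewrite !mulr_ge0 ?exprn_ge0 ?mulr_ge0.
  case: ifPn => [/forallP ag|_]; last by rewrite normr0.
  have dE := mdeg_sub ag.
  apply: (@le_trans _ _ (B1 * B2 * (M1 + M2) ^+ mdeg g)).
    rewrite normrM; apply: le_trans (ler_pM _ _ (Gc _) (Gd _)) _ => //.
    rewrite mulrACA ler_wpM2l ?mulr_ge0 // -[in leRHS]dE exprD ler_pM ?exprn_ge0 //.
      by rewrite lerXn2r ?nnegrE // lerDl.
    by rewrite lerXn2r ?nnegrE // lerDr.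
  rewrite exprMn -!mulrA !ler_wpM2l // mulrCA -[leLHS]mulr1 ler_wpM2l ?exprn_ge0 //.
  have hfV : 2 ^+ mdeg g * hf ^+ mdeg g = 1 by rewrite -exprMn mulfV ?expr1n ?pnatr_eq0.
  rewrite -[leLHS]hfV.
  by rewrite ler_wpM2l ?exprn_ge0 // ler_wiXn2l // -[leqRHS]dE leq_addr.
rewrite -mulr_sumr mulrAC ler_wpM2r ?exprn_ge0 ?mulr_ge0 //.
by rewrite ler_wpM2l ?mulr_ge0 // box_weight.
Qed.

(** The pairs of exponents whose sum stays in the box make up the partial sum of the Cauchy product;
    the pairs leaving the box are the error. *)
Lemma psum_conv c d u N :
  psum c u N * psum d u N - psum (conv c d) u N =
  \sum_(p : box N.+1 * box N.+1 | ~~ [forall i, p.1 i + p.2 i < N.+1]%N)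
    (c (fun i => p.1 i) * mono (fun i => p.1 i) u) *
    (d (fun i => p.2 i) * mono (fun i => p.2 i) u).
Proof.
have -> : psum (conv c d) u N =
    \sum_(p : box N.+1 * box N.+1 | [forall i, p.1 i + p.2 i < N.+1]%N)
    (c (fun i => p.1 i) * mono (fun i => p.1 i) u) *
    (d (fun i => p.2 i) * mono (fun i => p.2 i) u).
  rewrite -(pair_big_dep predT (fun a b : box N.+1 => [forall i, a i + b i < N.+1]%N)
    (fun a b : box N.+1 => (c (fun i => a i) * mono (fun i => a i) u) *
    (d (fun i => b i) * mono (fun i => b i) u))) /=.
  rewrite /psum /bsum /=; under eq_bigr do rewrite convE mulr_suml.
  rewrite (exchange_big_dep predT) //=; apply: eq_bigr => a _.
  rewrite (@sum_shift N (fun i => a i) (fun g =>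
    c (fun i => a i) * d (fun i => (g i - a i)%N) * mono g u)).
  apply: eq_bigr => b _; rewrite mono_add.
  rewrite (_ : (fun i => (a i + b i - a i)%N) = fun i => b i : nat).
    by rewrite mulrACA.
  by apply/funext => i; rewrite addKn.
rewrite {1 2}/psum /bsum big_distrlr /= pair_big /=.
rewrite (bigID (fun p : box N.+1 * box N.+1 => [forall i, p.1 i + p.2 i < N.+1]%N)) /=.
by rewrite addrAC subrr add0r.
Qed.

Lemma psum_conv_le c d B1 M1 B2 M2 s u N : growth c B1 M1 -> growth d B2 M2 ->
  0 <= B1 -> 0 <= M1 -> 0 <= B2 -> 0 <= M2 -> M1 * s <= qt -> M2 * s <= qt ->
  (forall i, `|u i| <= s) -> 0 <= s ->
  `|psum c u N * psum d u N - psum (conv c d) u N|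
    <= B1 * B2 * (2 ^+ n * 2 ^+ n) * hf ^+ N.
Proof.
move=> Gc Gd B10 M10 B20 M20 Ms1 Ms2 us s0; rewrite psum_conv.
apply: (norm_tail_sum (w := fun p : box N.+1 * box N.+1 =>
  (mdeg (fun i => p.1 i) + mdeg (fun i => p.2 i))%N)).
- exact: mulr_ge0.
- move=> p; rewrite normrM exprD mulrACA; apply: ler_pM => //.
    exact: (term_le _ Gc B10 M10 Ms1 us s0).
  exact: (term_le _ Gd B20 M20 Ms2 us s0).
- move=> p /forallPn[ i ]; rewrite -leqNgt -mdeg_add => Np.
  exact: leq_trans (ltnW Np) (leq_mdeg (fun i => p.1 i + p.2 i)%N i).
- exact: box_pair_weight.
Qed.

Lemma has_expansion_mul f g x0 : has_expansion f x0 -> has_expansion g x0 ->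
  has_expansion (fun x => f x * g x) x0.
Proof.
move=> [c1 [s1 [B1 [M1 [C1 E1]]]]] [c2 [s2 [B2 [M2 [C2 E2]]]]].
have [s [s0 ss1 ss2]] := pos_lower_bound (expands_s E1) (expands_s E2).
have C10 := expands_C E1; have C20 := expands_C E2.
have [s10 B10 M10 _ G1 _] := E1; have [s20 B20 M20 _ G2 _] := E2.
have qt0 : 0 < qt by rewrite invr_gt0 ltr0n.
have M0 : 0 <= 2 * (M1 + M2) by rewrite mulr_ge0 // addr_ge0.
have [t [t0 ts Mt]] := pos_lower_bound_mul M0 qt0 s0.
have [_ _ _ Mt1 _ R1] := expands_shrink E1 t0 (le_trans ts ss1).
have [_ _ _ Mt2 _ R2] := expands_shrink E2 t0 (le_trans ts ss2).
exists (conv c1 c2), t, (B1 * B2 * 2 ^+ n), (2 * (M1 + M2)),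
  (C1 * (C2 + B2 * 2 ^+ n) + B1 * 2 ^+ n * C2 + B1 * B2 * (2 ^+ n * 2 ^+ n)).
split => //.
- by rewrite !mulr_ge0 // exprn_ge0.
- exact: growth_conv.
- move=> x xt N.
  have r1 := R1 x xt N; have r2 := R2 x xt N; have r20 := R2 x xt 0%N.
  have n1 := psum_norm N G1 B10 M10 Mt1 xt (ltW t0).
  have n20 := psum_norm 0 G2 B20 M20 Mt2 xt (ltW t0).
  have r := psum_conv_le N G1 G2 B10 M10 B20 M20 Mt1 Mt2 xt (ltW t0).
  move: r1 r2 r20 n1 n20 r.
  set u := fun i => _; set p1 := psum c1 u N; set p2 := psum c2 u N.
  set p := psum _ u N; set p20 := psum c2 u 0 => r1 r2 r20 n1 n20 r.
  (* A bound on [g] independent of [N], from its partial sum at 0. *)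
  have gx : `|g x| <= C2 + B2 * 2 ^+ n.
    rewrite -(subrK p20 (g x)); apply: le_trans (ler_normD _ _) _.
    by apply: lerD => //; rewrite expr0 mulr1 in r20.
  have -> : f x * g x - p = (f x - p1) * g x + p1 * (g x - p2) + (p1 * p2 - p).
    ring.
  rewrite [leRHS]mulrDl; apply: le_trans (ler_normD _ _) _; apply: lerD => //.
  rewrite [leRHS]mulrDl; apply: le_trans (ler_normD _ _) _.
  rewrite !normrM; apply: lerD.
    by rewrite mulrAC ler_pM.
  by rewrite -mulrA ler_pM.
Qed.

Lemma has_expansion_cst (k : K) x0 : has_expansion (fun=> k) x0.
Proof.
pose c a : K := if mdeg a == 0%N then k else 0.
exists c, 1, `|k|, 0, 0; split => //.
- by rewrite mul0r.
- move=> a; rewrite /c; case: eqP => [->|_]; first by rewrite expr0 mulr1.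
  by rewrite normr0 mulr_ge0 // exprn_ge0.
- move=> x _ N; rewrite mul0r normr_le0 subr_eq0 /psum /bsum.
  rewrite (bigD1 [ffun => ord0]) //= big1 ?addr0; last first.
    move=> a a0; rewrite /c ifN ?mul0r //; apply: contra a0 => /eqP d0.
    apply/eqP/ffunP => i; apply: val_inj; rewrite /= ffunE /=.
    by apply/eqP; rewrite -leqn0 -d0 (leq_mdeg (fun i => a i)).
  rewrite /c (_ : mdeg _ = 0%N) ?eqxx.
    by rewrite /mono big1 ?mulr1 // => i _; rewrite ffunE.
  by rewrite /mdeg big1 // => i _; rewrite ffunE.
Qed.

Definition unit_exp (i : 'I_n) : 'I_n -> nat := fun j => (i == j) : nat.

Lemma mono_unit i u : mono (unit_exp i) u = u i.
Proof.
rewrite /mono (bigD1 i) //= /unit_exp eqxx expr1 big1 ?mulr1 //.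
by move=> j /negPf ji; rewrite eq_sym ji.
Qed.

Lemma mdeg_unit i : mdeg (unit_exp i) = 1%N.
Proof.
rewrite /mdeg (bigD1 i) //= /unit_exp eqxx big1 ?addn0 //.
by move=> j /negPf ji; rewrite eq_sym ji.
Qed.

Lemma has_expansion_linear i (x0 : 'rV[K]_n) :
  has_expansion (fun x : 'rV[K]_n => x 0 i - x0 0 i) x0.
Proof.
pose c a : K := (a == unit_exp i :> ('I_n -> nat))%:R.
pose C : K := 2.
exists c, qt, 1, 1, C; split => //; rewrite ?mul1r ?invr_gt0 ?ltr0n //.
- move=> a; rewrite expr1n mulr1 /c.
  by case: (_ == _); rewrite ?normr1 // normr0 ler01.
(* At N = 0 the box holds only the zero exponent, so the partial sum is 0 and the error is at most
   1/4; from N = 1 on the sum is exact. *)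
- move=> x xs [|N].
    rewrite /psum /bsum big1 ?subr0.
      rewrite expr0 mulr1; apply: le_trans (xs i) _.
      by rewrite /C (@le_trans _ _ 1) // ?invf_le1 ?ltr0n // ?ler1n.
    move=> a _; rewrite /c (_ : _ == _ = false) ?mul0r //.
    apply/negbTE/eqP => /(congr1 (fun a => a i)); rewrite /unit_exp eqxx.
    by case: (a i) => -[].
  have i_box j : (unit_exp i j < N.+2)%N by rewrite /unit_exp; case: (_ == _).
  pose e : box N.+2 := [ffun j => Ordinal (i_box j)].
  have eE : (fun j => e j : nat) = unit_exp i by apply/funext => j; rewrite ffunE.
  rewrite /psum /bsum (bigD1 e) //= big1 ?addr0; last first.
    move=> a ae; rewrite /c (_ : _ == _ = false) ?mul0r //.
    apply/negbTE; apply: contra ae => /eqP ae.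
    by apply/eqP/ffunP => j; apply: val_inj; rewrite ffunE /= -ae.
  rewrite /c eE eqxx mul1r mono_unit subrr normr0.
  by rewrite mulr_ge0 ?exprn_ge0.
Qed.

Lemma has_expansion_coord i (x0 : 'rV[K]_n) : has_expansion (fun x : 'rV[K]_n => x 0 i) x0.
Proof.
apply: (has_expansion_ext (U := setT) (f := fun x => (x 0 i - x0 0 i) + x0 0 i)) => //.
- exact: openT.
- by move=> x _; rewrite subrK.
- by apply: has_expansion_add; [exact: has_expansion_linear|exact: has_expansion_cst].
Qed.

(** * Termwise differentiation *)

Definition pow_rem (v h : K) m : K := (v + h) ^+ m - v ^+ m - h * (m%:R * v ^+ m.-1).

Lemma pow_remS (v h : K) m :
  pow_rem v h m.+1 = (v + h) * pow_rem v h m + m%:R * h ^+ 2 * v ^+ m.-1.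
Proof.
rewrite /pow_rem; case: m => [|m] /=; first by rewrite !expr0 !expr1; ring.
by rewrite !exprS; ring.
Qed.

(* The factor s^2 avoids the exponent m - 2. *)
Lemma pow_rem_le (v h s : K) m : 0 <= s -> `|v| <= s -> `|v + h| <= s ->
  s ^+ 2 * `|pow_rem v h m| <= m%:R ^+ 2 * `|h| ^+ 2 * s ^+ m.
Proof.
move=> s0 vs vhs; elim: m => [|m IH].
  by rewrite /pow_rem !expr0 subrr mul0r mulr0 subr0 normr0 mulr0 expr2 !mul0r.
rewrite pow_remS; apply: (@le_trans _ _
  (s * (m%:R ^+ 2 * `|h| ^+ 2 * s ^+ m) + m%:R * `|h| ^+ 2 * s ^+ m.+1)).
  apply: (@le_trans _ _ (s ^+ 2 * `|(v + h) * pow_rem v h m|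
      + s ^+ 2 * `|m%:R * h ^+ 2 * v ^+ m.-1|)).
    by rewrite -mulrDr ler_wpM2l ?exprn_ge0 // ler_normD.
  apply: lerD; first by rewrite normrM mulrCA ler_pM // mulr_ge0 // exprn_ge0.
  case: m {IH} => [|m]; first by rewrite !mul0r normr0 mulr0.
  rewrite !normrM normr_nat !normrX mulrCA ler_wpM2l ?mulr_ge0 ?exprn_ge0 //.
  by rewrite -[m.+2]add2n exprD ler_wpM2l ?exprn_ge0 // lerXn2r.
have -> : s * (m%:R ^+ 2 * `|h| ^+ 2 * s ^+ m) + m%:R * `|h| ^+ 2 * s ^+ m.+1
    = (m%:R ^+ 2 + m%:R) * `|h| ^+ 2 * s ^+ m.+1.
  by rewrite (exprS s m); move: (m%:R : K) (s ^+ m) `|h| => k sm k'; ring.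
rewrite ler_wpM2r ?exprn_ge0 // ler_wpM2r ?exprn_ge0 //.
rewrite -!natrX -natrD ler_nat -[in leqRHS]addn1 sqrnD exp1n muln1 mul2n -addnn.
by rewrite -addnA leq_add2l addnA leq_addl.
Qed.

Definition mono' (i : 'I_n) a u : K := \prod_(j | j != i) u j ^+ a j.

Lemma monoE i a u : mono a u = u i ^+ a i * mono' i a u.
Proof. by rewrite /mono (bigD1 i). Qed.

(** The derivative of the term of exponent [a], indexed by the exponent before differentiation;
    [dcoef] is indexed by the exponent after it. At [a i = 0] the truncated predecessor is
    multiplied by 0. *)
Definition dterm c i u a : K := c a * ((a i)%:R * u i ^+ (a i).-1 * mono' i a u).

Definition dcoef c i a : K := (a i).+1%:R * c (fun j => (unit_exp i j + a j)%N).

Lemma leq_nat_exp4 m : (m ^ 2 <= 4 ^ m)%N.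
Proof. by rewrite (_ : 4 = 2 ^ 2)%N // -expnM mulnC expnM leq_exp2r // ltnW // ltn_expl. Qed.

(** The factor a_i + 1 is at most 2^|a|, which doubles the growth rate. *)
Lemma growth_dcoef c i B M : growth c B M -> 0 <= B -> 0 <= M ->
  growth (dcoef c i) (B * M) (2 * M).
Proof.
move=> G B0 M0 a; rewrite /dcoef normrM normr_nat exprMn.
have -> : B * M * (2 ^+ mdeg a * M ^+ mdeg a) = 2 ^+ mdeg a * (B * (M * M ^+ mdeg a)).
  by ring.
rewrite ler_pM ?ler0n //.
  rewrite -natrX ler_nat; apply: leq_trans (ltn_expl (a i) (ltnSn 1)) _.
  by rewrite leq_exp2l // leq_mdeg.
by apply: le_trans (G _) _; rewrite mdeg_add mdeg_unit exprD expr1.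
Qed.

Lemma dterm_shift c i u a :
  dterm c i u (fun j => (unit_exp i j + a j)%N) = dcoef c i a * mono a u.
Proof.
have e : (unit_exp i i + a i = (a i).+1)%N by rewrite /unit_exp eqxx add1n.
rewrite /dterm /dcoef (monoE i) e /=.
have -> : mono' i (fun j => (unit_exp i j + a j)%N) u = mono' i a u.
  by apply: eq_bigr => j /negPf ji; rewrite /unit_exp eq_sym ji.
by rewrite -!mulrA mulrCA.
Qed.

(** Differentiation lowers the i-th exponent, so the two sums differ only by the exponents that
    leave the box when it is raised again. *)
Lemma dterm_sum_le c i B M s u N : growth c B M -> 0 <= B -> 0 <= M ->
  2 * M * s <= qt -> (forall i, `|u i| <= s) -> 0 <= s ->
  `|psum (dcoef c i) u N - bsum N.+1 (dterm c i u)| <= B * M * 2 ^+ n * hf ^+ N.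
Proof.
move=> G B0 M0 Ms us s0.
have -> : bsum N.+1 (dterm c i u) =
    \sum_(b : box N.+1 | [forall j, unit_exp i j + b j < N.+1]%N)
      dcoef c i (fun j => b j) * mono (fun j => b j) u.
  rewrite /bsum (bigID (fun a : box N.+1 => [forall j, unit_exp i j <= a j]%N)) /=.
  rewrite addrC big1 ?add0r; last first.
    move=> a /forallPn[j]; rewrite -ltnNge /unit_exp.
    case: eqVneq => // <-; rewrite ltnS leqn0 => /eqP ai0.
    by rewrite /dterm ai0 !mul0r mulr0.
  rewrite (@sum_shift N (unit_exp i) (dterm c i u)).
  by apply: eq_bigr => b _; rewrite dterm_shift.
rewrite /psum /bsum (bigID (fun b : box N.+1 => [forall j, unit_exp i j + b j < N.+1]%N)) /=.
rewrite addrAC subrr add0r.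
apply: (norm_tail_sum (w := fun a : box N.+1 => mdeg (fun i => a i))).
- exact: mulr_ge0.
- move=> b; apply: (term_le _ (growth_dcoef i G B0 M0) _ _ Ms us s0).
    exact: mulr_ge0.
  exact: mulr_ge0.
- move=> b /forallPn[j]; rewrite -leqNgt => Nb.
  have := leq_trans Nb (leq_mdeg (fun j => unit_exp i j + b j)%N j).
  by rewrite mdeg_add mdeg_unit.
- exact: box_weight.
Qed.

Definition translate u (i : 'I_n) (h : K) : 'I_n -> K :=
  fun j => u j + (if j == i then h else 0).

(** A quadratic Taylor bound uniform in [N]. The factor m^2 of [pow_rem_le] is at most 4^m, and the
    bound 1/16 on [M * s] leaves 4/16 = 1/4, as [norm_tail_sum] requires. *)
Lemma psum_rem_le c i B M s u h N : growth c B M -> 0 <= B -> 0 <= M ->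
  M * s <= 16^-1 -> (forall j, `|u j| <= s) -> `|u i + h| <= s -> 0 <= s ->
  s ^+ 2 * `|psum c (translate u i h) N - psum c u N - h * bsum N.+1 (dterm c i u)|
    <= B * `|h| ^+ 2 * 2 ^+ n.
Proof.
move=> G B0 M0 Ms us uhs s0.
have -> : psum c (translate u i h) N - psum c u N - h * bsum N.+1 (dterm c i u)
    = \sum_(a : box N.+1) c (fun j => a j) * mono' i (fun j => a j) u * pow_rem (u i) h (a i).
  rewrite /psum /bsum mulr_sumr -!sumrB; apply: eq_bigr => a _.
  rewrite !(monoE i) /dterm /pow_rem.
  have -> : mono' i (fun j => a j) (translate u i h) = mono' i (fun j => a j) u.
    by apply: eq_bigr => j /negPf ji; rewrite /translate ji addr0.
  by rewrite {1}/translate eqxx; ring.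
rewrite -[s ^+ 2]ger0_norm ?exprn_ge0 // -normrM mulr_sumr.
rewrite -[leRHS]mulr1 -(expr0 hf).
apply: (norm_tail_sum (w := fun a : box N.+1 => mdeg (fun i => a i))) => //.
- by rewrite mulr_ge0 // exprn_ge0.
- move=> a; pose d' := (\sum_(j | j != i) a j)%N.
  have dE : mdeg (fun j => a j) = (a i + d')%N by rewrite /mdeg (bigD1 i).
  have m'le : `|mono' i (fun j => a j) u| <= s ^+ d'.
    rewrite normr_prod expr_sum; apply: ler_prod => j _.
    by rewrite normr_ge0 normrX lerXn2r // nnegrE.
  rewrite mulrCA normrM normrM [`|s ^+ 2 * _|]normrM (ger0_norm (exprn_ge0 2 s0)).
  apply: (@le_trans _ _ (B * M ^+ (a i + d') * s ^+ d' *
      ((a i)%:R ^+ 2 * `|h| ^+ 2 * s ^+ a i))).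
    apply: ler_pM; rewrite ?mulr_ge0 ?exprn_ge0 //; last exact: pow_rem_le.
    by apply: ler_pM => //; rewrite -dE.
  have -> : B * M ^+ (a i + d') * s ^+ d' * ((a i)%:R ^+ 2 * `|h| ^+ 2 * s ^+ a i)
      = B * `|h| ^+ 2 * ((a i)%:R ^+ 2 * (M * s) ^+ (a i + d')).
    by rewrite exprMn !exprD; ring.
  rewrite ler_wpM2l ?mulr_ge0 ?exprn_ge0 // dE.
  apply: (@le_trans _ _ (4 ^+ (a i + d') * 16^-1 ^+ (a i + d'))).
    apply: ler_pM; rewrite ?exprn_ge0 ?mulr_ge0 //.
      rewrite -!natrX ler_nat; apply: leq_trans (leq_nat_exp4 _) _.
      by rewrite leq_exp2l // leq_addr.
    by rewrite lerXn2r // nnegrE ?mulr_ge0 ?invr_ge0.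
  rewrite -exprMn (_ : 4 * 16^-1 = qt) //.
  by rewrite (_ : 16 = 4 * 4 :> K) ?invfM ?mulKf ?mulVKf ?pnatr_eq0 // -natrM.
- exact: box_weight.
Qed.

Hypothesis complete : forall (u : nat -> K) (C : K),
  (forall N L, (N <= L)%N -> `|u L - u N| <= C * hf ^+ N) ->
  exists l, forall e, 0 < e -> exists N, forall L, (N <= L)%N -> `|l - u L| < e.

Lemma complete_rate (u : nat -> K) (C : K) : 0 <= C ->
  (forall N L, (N <= L)%N -> `|u L - u N| <= C * hf ^+ N) ->
  exists l : K, forall N, `|l - u N| <= C * hf ^+ N.
Proof.
move=> C0 cu; have [l ul] := complete cu; exists l => N.
apply: le_of_le_add_eps; rewrite ?normr_real //.
  by rewrite ger0_real // mulr_ge0 // exprn_ge0.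
move=> e e0; have [N1 HN1] := ul e e0.
have L1 : (N1 <= maxn N N1)%N by rewrite leq_maxr.
apply: le_trans (ler_distD (u (maxn N N1)) _ _) _; rewrite addrC.
by apply: lerD; [apply: cu; exact: leq_maxl|apply: ltW; exact: HN1].
Qed.

(** Let [l] be the limit of the derived series. Comparing with partial sums bounds the first-order
    remainder of [f] by D |h|^2 plus an error of order 2^-N; letting N grow removes the error, so
    [l] is the derivative. This is done at all points near [x0], so the derived series expands
    [pder i f]. *)
Lemma has_expansion_derive f i x0 : has_expansion f x0 ->
  derivable (f : _ -> K^o) x0 (basis_vector K i) /\ has_expansion (pder i f) x0.
Proof.
move=> [c [s [B [M [C E]]]]]; have C0 := expands_C E.
have [s0 B0 M0 _ G _] := E.
have e16 : 0 < 16^-1 :> K by rewrite invr_gt0 ltr0n.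
have [t [t0 ts Mt]] := pos_lower_bound_mul M0 e16 s0.
have [_ _ _ _ _ R] := expands_shrink E t0 ts.
have M20 : 0 <= 2 * M by rewrite mulr_ge0.
have Mt2 : 2 * M * t <= qt.
  rewrite -mulrA; apply: (@le_trans _ _ (2 * 16^-1)); first by rewrite ler_wpM2l.
  rewrite ler_pdivrMr ?ltr0n // mulrC (_ : 16 = 4 * 4 :> K) -?natrM //.
  by rewrite natrM mulfK ?pnatr_eq0 // ler_nat.
have Gd := growth_dcoef i G B0 M0.
have BM0 := mulr_ge0 B0 M0.
pose u (x : 'rV[K]_n) j := x 0 j - x0 0 j.
have lim x : (forall j, `|u x j| <= t) -> exists l, forall N,
    `|l - psum (dcoef c i) (u x) N| <= B * M * 2 ^+ n * hf ^+ N.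
  move=> xt; apply: complete_rate; first by rewrite mulr_ge0 // exprn_ge0.
  by move=> N L NL; apply: (psum_cauchy Gd BM0 M20 Mt2 xt (ltW t0) NL).
(* For a point within t/2 and an increment of norm at most t/2, the translated point stays in the
   polydisc of radius [t]. *)
have t2 : 0 < t / 2 by rewrite divr_gt0 ?ltr0n.
have t2t : t / 2 <= t by rewrite ler_pdivrMr ?ltr0n // ler_peMr ?(ltW t0) // ler1n.
have derive x l : (forall j, `|u x j| <= t / 2) ->
    (forall N, `|l - psum (dcoef c i) (u x) N| <= B * M * 2 ^+ n * hf ^+ N) ->
    is_derive x (basis_vector K i) (f : _ -> K^o) l.
  move=> xt2 xl; have xt j : `|u x j| <= t by apply: le_trans (xt2 j) t2t.
  pose D := B * 2 ^+ n / t ^+ 2.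
  have D0 : 0 <= D by rewrite !mulr_ge0 ?invr_ge0 ?exprn_ge0 // ltW.
  have bound h : `|h| <= t / 2 ->
      `|f (h *: basis_vector K i + x) - f x - h * l| <= D * `|h| ^+ 2.
    move=> ht; pose x' := h *: basis_vector K i + x.
    have x'E : u x' = translate (u x) i h.
      apply/funext => j; rewrite /u /translate !mxE eqxx /=.
      by case: (j == i); rewrite ?mulr1 ?mulr0; ring.
    have uih : `|u x i + h| <= t.
      by rewrite [leRHS]splitr; apply: le_trans (ler_normD _ _) _; exact: lerD.
    have x't j : `|u x' j| <= t.
      rewrite x'E /translate; case: eqP => [->//|_]; rewrite addr0; exact: xt.
    (* Two approximation errors of [f], and [t] times those of [l] and of the termwise
       derivative. *)
    pose C3 := C + C + t * (B * M * 2 ^+ n + B * M * 2 ^+ n).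
    have C30 : 0 <= C3.
      by rewrite !addr_ge0 ?mulr_ge0 ?addr_ge0 ?mulr_ge0 ?exprn_ge0 // ltW.
    apply: (@le_of_le_rate _ _ C3) => //.
      by rewrite ger0_real // mulr_ge0 // exprn_ge0.
    move=> N; have r1 := R x' x't N; have r2 := R x xt N; have r3 := xl N.
    have r4 := dterm_sum_le i N G B0 M0 Mt2 xt (ltW t0).
    have r5 := psum_rem_le N G B0 M0 Mt xt uih (ltW t0).
    rewrite -/(u x') x'E in r1.
    move: r1 r2 r3 r4 r5.
    rewrite -/(u x); set p' := psum c (translate _ _ _) N; set p := psum c _ N.
    set q := psum (dcoef _ _) _ N; set T := bsum _ _ => r1 r2 r3 r4 r5.
    have -> : f x' - f x - h * l =
      (p' - p - h * T) + ((f x' - p') - (f x - p) - h * ((l - q) + (q - T))) by ring.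
    apply: le_trans (ler_normD _ _) _; apply: lerD.
      by rewrite /D [leRHS]mulrAC ler_pdivlMr ?exprn_gt0 // [leLHS]mulrC [leRHS]mulrAC.
    rewrite /C3 [leRHS]mulrDl; apply: le_trans (ler_normB _ _) _; apply: lerD.
      rewrite [leRHS]mulrDl; apply: le_trans (ler_normB _ _) _; exact: lerD.
    rewrite normrM -[leRHS]mulrA; apply: ler_pM => //; first exact: le_trans ht t2t.
    rewrite [leRHS]mulrDl; apply: le_trans (ler_normD _ _) _; exact: lerD.
  have cv : (fun h : K => h^-1 *: (((f : _ -> K^o) \o shift x) (h *: basis_vector K i)
      - f x)) @ 0^' --> (l : K^o).
    apply/cvgrPdist_le => e e0.
    have [r [r0 rt Dr]] := pos_lower_bound_mul D0 e0 t2.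
    near=> h.
    have h0 : h != 0 by near: h; exact: nbhs_dnbhs_neq.
    have hr : `|h| <= r by near: h; exact: dnbhs0_le.
    rewrite distrC -(@ler_pM2l _ `|h|) ?normr_gt0 // -[leLHS]normrM mulrBr.
    rewrite -[h * (_ *: _)]/(h *: (_ *: _)) scalerA mulfV // scale1r /=.
    apply: le_trans (bound h (le_trans hr rt)) _.
    rewrite expr2 mulrCA ler_wpM2l //; apply: le_trans Dr.
    by rewrite ler_wpM2l.
  by split; [apply/cvg_ex; exists l; exact: cv|apply: cvg_lim cv].
have u0 j : `|u x0 j| <= t / 2 by rewrite /u subrr normr0 ltW.
split.
  have [l xl] := lim x0 (fun j => le_trans (u0 j) t2t).
  by have [] := derive x0 l u0 xl.
exists (dcoef c i), (t / 2), (B * M), (2 * M), (B * M * 2 ^+ n); split => //.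
  by apply: le_trans Mt2; rewrite ler_wpM2l.
move=> x xt2 N; have [l xl] := lim x (fun j => le_trans (xt2 j) t2t).
by have [_] := derive x l xt2 xl; rewrite /pder => ->; exact: xl.
Unshelve. all: end_near. Qed.

Lemma analytic_calculus : calculus (@analytic K n).
Proof.
have X U f : analytic U f -> forall x, U x -> has_expansion f x.
  by move=> fa x; exact: analytic_has_expansion.
split.
- move=> U f g oU fg /X fa; apply: has_expansion_analytic => x Ux.
  exact: has_expansion_ext fg (fa x Ux).
- by move=> U V f oU oV VU fa x /VU; exact: fa.
- by move=> U a oU; apply: has_expansion_analytic => x _; exact: has_expansion_cst.
- by move=> U i oU; apply: has_expansion_analytic => x _; exact: has_expansion_coord.
- move=> U f g oU /X fa /X ga; apply: has_expansion_analytic => x Ux.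
  by apply: has_expansion_add; [exact: fa|exact: ga].
- move=> U f g oU /X fa /X ga; apply: has_expansion_analytic => x Ux.
  by apply: has_expansion_mul; [exact: fa|exact: ga].
- by move=> U f i x oU /X fa Ux; have [] := has_expansion_derive i (fa x Ux).
- move=> U f i oU /X fa; apply: has_expansion_analytic => x Ux.
  by have [] := has_expansion_derive i (fa x Ux).
Qed.

End PowerSeries.

(** * The ground fields *)

(** The base consists of the balls with centre in the countable dense set and radius 2^-N; twice
    that radius is below [e], so such a ball around [x] stays in the given one. *)
Lemma second_countable_rV (K : numFieldType) (n : nat) (T : countType) (D : T -> K) :
  (forall e : K, 0 < e -> exists N, 2^-1 ^+ N < e) ->
  (forall (x e : K), 0 < e -> exists q, `|x - D q| < e) ->
  @second_countable 'rV[K]_n.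
Proof.
move=> arch dense.
pose B (p : 'rV[T]_n * nat) : set 'rV[K]_n := ball (map_mx D p.1) (2^-1 ^+ p.2).
exists (range (fun p => B p)).
  exact: card_le_trans (card_image_le _ _) (countableP _).
split; first by move=> _ [p _ <-]; exact: ball_open.
move=> x A /nbhs_ballP[e /= e0 eA].
have [N Ne] := arch _ (divr_gt0 e0 (ltr0Sn K 1)).
have N0 : 0 < 2^-1 ^+ N :> K by rewrite exprn_gt0 // invr_gt0 ltr0n.
have /choice[q Hq] : forall i : 'I_n, exists q, `|x 0 i - D q| < 2^-1 ^+ N.
  by move=> i; exact: dense.
have qx : ball (map_mx D (\row_i q i)) (2^-1 ^+ N) x.
  by split=> // i j; rewrite ord1 !mxE /ball /= distrC.
exists (B (\row_i q i, N)); first by split => //; exists (\row_i q i, N).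
move=> y qy; apply: eA.
apply: (@le_ball _ _ _ (2^-1 ^+ N + 2^-1 ^+ N)).
  by rewrite (splitr e) lerD // ltW.
exact: ball_triangle (ball_sym qx) qy.
Qed.

Section GroundFields.
Variable R : realType.
Local Notation toC := (real_complex R).

Lemma real_half_exp_small (e : R) : 0 < e -> exists N, 2^-1 ^+ N < e.
Proof.
move=> e0; exists (Num.bound e^-1).
rewrite exprVn invf_plt ?posrE ?exprn_gt0 //.
apply: lt_trans (archi_boundP _) _; first by rewrite invr_ge0 ltW.
by rewrite -natrX ltr_nat ltn_expl.
Qed.

Lemma real_geometric_complete (u : nat -> R) (C : R) :
  (forall N L, (N <= L)%N -> `|u L - u N| <= C * 2^-1 ^+ N) ->
  exists l, forall e, 0 < e -> exists N, forall L, (N <= L)%N -> `|l - u L| < e.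
Proof.
move=> cu.
have C0 : 0 <= C by have := cu 0%N 0%N (leqnn _); rewrite subrr normr0 expr0 mulr1.
suff ul : cvg (u @ \oo).
  exists (lim (u @ \oo)) => e e0.
  by have /cvgrPdist_lt/(_ e e0)[N _ HN] := ul; exists N => L /HN.
apply: cauchy_cvg; apply: cauchy_exP => e e0.
have [N HN] := arch_lt real_half_exp_small C0 e0.
exists (u N); exists N => // L NL.
by rewrite /ball /= distrC; apply: le_lt_trans (cu N L NL) (HN N (leqnn _)).
Qed.

Lemma real_rat_dense (x e : R) : 0 < e -> exists q : rat, `|x - ratr q| < e.
Proof.
move=> e0; have /rat_in_itvoo[q] : x < x + e by rewrite ltrDl.
rewrite in_itv /= => /andP[xq qx]; exists q.
by rewrite distrC gtr0_norm ?subr_gt0 // ltrBlDl.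
Qed.

(** Positive complex numbers are real, so every tolerance can be taken in [R]. *)
Lemma complex_gt0 (e : R[i]) : 0 < e -> exists2 r : R, 0 < r & e = toC r.
Proof.
move=> e0; have e_real := RRe_real (gtr0_real e0).
by exists (complex.Re e); rewrite -?ltcR e_real.
Qed.

Lemma complex_half_exp N : toC (2^-1 ^+ N) = 2^-1 ^+ N.
Proof. by rewrite rmorphXn fmorphV rmorph_nat. Qed.

Lemma complex_half_exp_small (e : R[i]) : 0 < e -> exists N, 2^-1 ^+ N < e.
Proof.
move=> /complex_gt0[r r0 ->]; have [N Nr] := real_half_exp_small r0.
by exists N; rewrite -complex_half_exp ltcR.
Qed.

Lemma norm_Im_le (z : R[i]) : toC `|complex.Im z| <= `|z|.
Proof.
have -> : `|z| = `|z * 'i%C|.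
  (* Multiplying by i preserves the norm and turns the imaginary part into a real part, up to
     sign. *)
  by rewrite normrM [`|'i%C|]normc_def /= expr0n expr1n add0r sqrtr1 mulr1.
by rewrite -normrN -ReiNIm; exact: normc_ge_Re.
Qed.

Lemma complex_norm_le (z : R[i]) :
  `|z| <= toC (`|complex.Re z| + `|complex.Im z|).
Proof.
rewrite normc_def lecR -[leRHS]ger0_norm ?addr_ge0 // -sqrtr_sqr.
rewrite ler_sqrt ?sqr_ge0 // sqrrD !real_normK ?num_real //.
by rewrite [leRHS]addrAC lerDl mulrn_wge0 // mulr_ge0.
Qed.

Lemma complex_geometric_complete (u : nat -> R[i]) (C : R[i]) :
  (forall N L, (N <= L)%N -> `|u L - u N| <= C * 2^-1 ^+ N) ->
  exists l, forall e, 0 < e -> exists N, forall L, (N <= L)%N -> `|l - u L| < e.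
Proof.
move=> cu.
have C0 : 0 <= C by have := cu 0%N 0%N (leqnn _); rewrite subrr normr0 expr0 mulr1.
have CE : C = toC (complex.Re C) by rewrite RRe_real // ger0_real.
(* Real and imaginary parts are additive and do not increase the norm, so they inherit the geometric
   rate, whose constant is nonnegative and hence real. *)
have part (p : R[i] -> R) : {morph p : x y / x - y} ->
    (forall z, toC `|p z| <= `|z|) -> exists l : R, forall e, 0 < e ->
      exists N, forall L, (N <= L)%N -> `|l - p (u L)| < e.
  move=> pB ple; apply: (@real_geometric_complete _ (complex.Re C)) => N L NL.
  rewrite -lecR [leRHS]rmorphM /= complex_half_exp -CE /= -pB.
  exact: le_trans (ple _) (cu N L NL).
have [a ua] := part (@complex.Re R) (fun x y => raddfB _ x y) (@normc_ge_Re R).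
have [b ub] := part (@complex.Im R) (fun x y => raddfB _ x y) norm_Im_le.
exists (a +i* b)%C => e /complex_gt0[r r0 ->].
have r2 : 0 < r / 2 by rewrite divr_gt0.
have [N1 HN1] := ua _ r2; have [N2 HN2] := ub _ r2.
exists (maxn N1 N2) => L; rewrite geq_max => /andP[NL1 NL2].
apply: le_lt_trans (complex_norm_le _) _.
by rewrite ltcR [ltRHS]splitr !raddfB /= ltrD ?HN1 ?HN2.
Qed.

Lemma complex_rat_dense (x e : R[i]) : 0 < e ->
  exists q : rat * rat, `|x - (ratr q.1 +i* ratr q.2)%C| < e.
Proof.
move=> /complex_gt0[r r0 ->]; have r2 : 0 < r / 2 by rewrite divr_gt0.
have [q1 Hq1] := real_rat_dense (complex.Re x) r2.
have [q2 Hq2] := real_rat_dense (complex.Im x) r2.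
exists (q1, q2); apply: le_lt_trans (complex_norm_le _) _.
by rewrite ltcR [ltRHS]splitr !raddfB /= ltrD.
Qed.

End GroundFields.

Theorem proposition4p33 (R : realType) (k : category) :
  exists (M : manifold (functions R k)) (F : singular_foliation M) (m : M)
    (r : nat),
    is_rank F m r /\
    forall U : set M, open U -> U m ->
      ~ exists A : lie_algebroid U r, induces A F.
Proof.
have scR := second_countable_rV 3 (@real_half_exp_small R) (@real_rat_dense R).
have scC := second_countable_rV 3 (@complex_half_exp_small R) (@complex_rat_dense R).
(* The power series argument is shared by both analytic categories: only smallness of 2^-N and
   geometric completeness are supplied for each field. *)
have anaR := @analytic_calculus R 3 (@real_half_exp_small R) (@real_geometric_complete R).
have anaC := @analytic_calculus R[i]%C 3 (@complex_half_exp_small R)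
  (@complex_geometric_complete R).
case: k.
- exact: (@not_induced_by_minimal_rank (functions R Smooth) (@smooth_calculus R 3) scR).
- exact: (@not_induced_by_minimal_rank (functions R RealAnalytic) anaR scR).
- exact: (@not_induced_by_minimal_rank (functions R Holomorphic) anaC scC).
Qed.
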